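(* Let $s,s'\in\mathbb C$ with $\chi(s),\chi(s')\notin\{\pm1\}$, and let $\phi,\phi'\colon\mathfrak X\to\mathbb C$ be $\Gamma$-invariant functions with $\Delta\phi=\chi(s)\phi$ and $\Delta\phi'=\chi(s')\phi'$. Then, as elements of $\mathcal D'(\mathfrak P_\Gamma)$, $$\mathrm{PS}^\Gamma_{\phi,\phi'}=\mathbf I_+(s)(\phi)\otimes\mathbf I_-(-\overline{s'})(\overline{\phi'}).$$
   Context: Let $q\ge2$ and let $\mathfrak G=(\mathfrak X,\mathfrak E)$ be the $(q+1)$-regular tree, with vertex set $\mathfrak X$, set $\mathfrak E\subseteq\mathfrak X^2$ of directed edges (both orientations of each edge) and graph distance $d$. For $\vec e=(a,b)$ put $\iota(\vec e)=a$, $\tau(\vec e)=b$. A (forward) chain is a sequence $(\vec e_1,\vec e_2,\dots)$ of directed edges with $\tau(\vec e_i)=\iota(\vec e_{i+1})$ and $\tau(\vec e_{i+1})\ne\iota(\vec e_i)$. The boundary $\Omega$ is the set of infinite chains modulo ''eventually equal up to an index shift'', with the topology generated by the sets $\partial_+\vec e$ of classes represented by chains starting with $\vec e$; it is compact and totally disconnected. For $x\in\mathfrak X,\omega\in\Omega$, $[x,\omega)$ is the geodesic ray from $x$ to $\omega$; for $\omega\neq\omega'$, $]\omega',\omega[$ is the vertex set of the bi-infinite geodesic joining them. Fix a base vertex $o$. The horocycle bracket is $\langle x,\omega\rangle=d(o,y)-d(x,y)$, where $[o,\omega)\cap[x,\omega)=[y,\omega)$. For $s\in\mathbb C$ let $p_s(x,\omega)=q^{(\frac12+is)\langle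 x,\omega\rangle}$, $\chi(s)=\frac{\sqrt q}{q+1}(q^{is}+q^{-is})$, and $\Delta f(x)=\frac1{q+1}\sum_{d(x,y)=1}f(y)$. $\mathcal D'(\Omega)$ is the algebraic dual of the space of locally constant functions on $\Omega$ (equivalently finitely additive complex measures on clopen sets); we write $\int f\,d\mu=\mu(f)$, similarly for tensor products $\mu\otimes\mu'$ on $\Omega\times\Omega$, and $\overline\mu(f):=\overline{\mu(\overline f)}$. The Poisson transform is $\mathcal P_s\mu(x)=\int_\Omega p_s(x,\omega)\,d\mu(\omega)$; if $\chi(s)\notin\{\pm1\}$ it is a linear bijection from $\mathcal D'(\Omega)$ onto $\{\phi:\Delta\phi=\chi(s)\phi\}$, and the boundary value $\mu_{s,\phi}$ of such $\phi$ is the unique $\mu$ with $\mathcal P_s\mu=\phi$. $\Gamma\le\mathrm{Aut}(\mathfrak G)$ is a discrete subgroup acting freely on $\mathfrak X$ with finite quotient $\Gamma\backslash\mathfrak X$. Let $\mathfrak P$ be the set of triples $(\omega',\omega,x)\in\Omega\times\Omega\times\mathfrak X$ with $\omega'\ne\omega$ and $x\in]\omega',\omega[$ (subspace topology, $\mathfrak X$ discrete), with diagonal $\Gamma$-action and compact quotient $\mathfrak P_\Gamma=\Gamma\backslash\mathfrak P$; $C^{\mathrm{lc}}(\mathfrak P_\Gamma)$ denotes the $\Gamma$-invariant locally constant functions on $\mathfrak P$ and $\mathcal D'(\mathfrak P_\Gamma)$ its algebraic dual. Choose $\Xi_{\mathfrak P}$ locally constant with compact support on $\mathfrak P$ and $\sum_{\gamma\in\Gamma}\Xi_{\mathfrak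 P}(\gamma p)=1$ for all $p$. The Patterson–Sullivan distribution is $$\mathrm{PS}^\Gamma_{\phi,\phi'}(F)=\int_{\Omega\times\Omega}\sum_{x\in]\omega',\omega[}\Xi_{\mathfrak P}(\omega',\omega,x)F(\omega',\omega,x)\,p_s(x,\omega)\,p_{-\overline{s'}}(x,\omega')\,d\mu_{s,\phi}(\omega)\,d\overline{\mu_{s',\phi'}}(\omega'),$$ the integrand being $0$ for $\omega=\omega'$ (it is independent of the choice of $\Xi_{\mathfrak P}$). Shift spaces: $\mathfrak P^+$ is the set of forward chains $(\vec e_1,\vec e_2,\dots)$, $\mathfrak P^-$ the set of backward chains $(\dots,\vec e_2,\vec e_1)$ (with $\tau(\vec e_{i+1})=\iota(\vec e_i)$, $\iota(\vec e_{i+1})\neq\tau(\vec e_i)$), each with the topology generated by cylinder sets fixing finitely many edges at the start $\vec e_1,\dots,\vec e_n$. $\pi_+(\vec e_1,\dots)=\iota(\vec e_1)$, $\pi_-(\dots,\vec e_1)=\tau(\vec e_1)$. $\mathcal D'(\mathfrak P^\pm)$ is the algebraic dual of the compactly supported locally constant functions. Transfer operators: $\mathcal L_+f(\vec e_1,\vec e_2,\dots)=\sum f(\vec e_0,\vec e_1,\dots)$ over $\vec e_0$ with $(\vec e_0,\vec e_1,\dots)\in\mathfrak P^+$, and $\mathcal L_-f(\dots,\vec e_2,\vec e_1)=\sum f(\dots,\vec e_1,\vec e_0)$ over $\vec e_0$ with $(\dots,\vec e_1,\vec e_0)\in\mathfrak P^-$; $\mathcal L'_\pm$ are their transposes and $\mathcal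 E_s(\mathcal L'_\pm)=\{u\in\mathcal D'(\mathfrak P^\pm):\mathcal L'_\pm u=q^{\frac12+is}u\}$. The pushforward is $\pi_{\pm,*}u(x)=u(\mathbb 1_{\pi_\pm^{-1}(x)})$; for $\chi(s)\notin\{\pm1\}$ it restricts to a $\Gamma$-equivariant linear isomorphism $\mathcal E_s(\mathcal L'_\pm)\to\{\phi:\Delta\phi=\chi(s)\phi\}$. For $\Gamma$-invariant such $\phi$, $\mathbf I_\pm(s)(\phi)\in\mathcal D'(\mathfrak P^\pm_\Gamma)$ ($\mathfrak P^\pm_\Gamma=\Gamma\backslash\mathfrak P^\pm$, distributions = algebraic dual of $\Gamma$-invariant locally constant functions) is $F\mapsto U((F\circ\mathrm{pr})\,\Xi_\pm)$ with $U=(\pi_{\pm,*})^{-1}(\phi)$ and $\Xi_\pm$ compactly supported locally constant on $\mathfrak P^\pm$ with $\sum_\gamma\Xi_\pm(\gamma\mathbf p)=1$. For $u_\pm\in\mathcal D'(\mathfrak P^\pm_\Gamma)$, $(u_+\otimes u_-)(\varphi)=u_+\big(\mathbf p_+\mapsto u_-(\varphi(\mathbf p_+,\cdot))\big)$. $\mathfrak P_\Gamma$ embeds in $\mathfrak P^+_\Gamma\times\mathfrak P^-_\Gamma$ via $\Gamma(\omega',\omega,x)\mapsto(\Gamma[x,\omega),\Gamma\mathbf p_-)$, where $[x,\omega)$ is viewed as a forward chain and $\mathbf p_-$ is the backward chain along $]\omega',\omega[$ coming from $\omega'$ and ending at $x$; functions on $\mathfrak P_\Gamma$ are extended by zero,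 so $u_+\otimes u_-$ defines an element of $\mathcal D'(\mathfrak P_\Gamma)$. *)

(* Defs.v *)
(* MathComp + MathComp-Analysis + real-closed complex numbers.
   Complex numbers are R[i] for an arbitrary realType R. *)
From HB Require Import structures.
From mathcomp Require Import all_boot all_order all_algebra.
From mathcomp Require Import all_classical all_reals all_analysis.
From mathcomp Require Import complex.
From Stdlib Require List.
Set Implicit Arguments. Unset Strict Implicit. Unset Printing Implicit Defensive.
Import Order.TTheory GRing.Theory Num.Theory ComplexField.
Local Open Scope classical_set_scope.
Local Open Scope ring_scope.
Local Open Scope complex_scope.

(* Elementary topology given by a family of basic open sets B.         *)
Section Topo.
Variables (R : realType) (T : Type).
Local Notation C := R[i].

(* U is open for the topology with basis B *)
Definition b_open (B : set (set T)) (U : set T) :=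
  forall x, U x -> exists b, B b /\ b x /\ b `<=` U.

(* K is compact: every open cover has a finite subcover *)
Definition b_compact (B : set (set T)) (K : set T) :=
  forall (I : Type) (V : I -> set T), (forall i, b_open B (V i)) ->
    (forall x, K x -> exists i, V i x) ->
    exists l : list I, forall x, K x -> exists i, List.In i l /\ V i x.

(* f is locally constant on the subspace D *)
Definition loc_const (B : set (set T)) (D : set T) (f : T -> C) :=
  forall x, D x -> exists b, B b /\ b x /\ forall y, D y -> b y -> f y = f x.

(* f has compact support in the subspace D *)
Definition comp_supp (B : set (set T)) (D : set T) (f : T -> C) :=
  exists K, K `<=` D /\ b_compact B K /\ forall x, D x -> f x <> 0 -> K x.

Definition test_fun (B : set (set T)) (D : set T) (f : T -> C) :=
  loc_const B D f /\ comp_supp B D f.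

(* u is an element of the algebraic dual of the space V of functions on the
   subspace D (functions on D are represented by functions on T, so u must
   only depend on the restriction to D) *)
Definition alg_dual (V : (T -> C) -> Prop) (D : set T) (u : (T -> C) -> C) :=
  (forall a f g, V f -> V g -> u (fun x => a * f x + g x) = a * u f + u g) /\
  (forall f g, V f -> V g -> (forall x, D x -> f x = g x) -> u f = u g).
End Topo.

(* The (q+1)-regular tree, its boundary, Poisson kernels, ...          *)
Section Tree.
Variables (R : realType) (q : nat) (X : choiceType) (adj : X -> X -> Prop).
Local Notation C := R[i].

(* walks x = p_0, p_1, ..., p_n = y (as vertex lists) *)
Definition walk (x y : X) (p : seq X) :=
  [/\ (0 < size p)%N, nth x p 0 = x, last x p = y &
      forall i, (i.+1 < size p)%N -> adj (nth x p i) (nth x p i.+1)].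
Definition reduced_walk (x y : X) (p : seq X) :=
  walk x y p /\ forall i, (i.+2 < size p)%N -> nth x p i.+2 <> nth x p i.

(* simple graph which is a tree: unique reduced path between two vertices *)
Definition is_tree :=
  [/\ forall x y, adj x y -> adj y x, forall x, ~ adj x x &
      forall x y, exists! p, reduced_walk x y p].

Definition regular_deg :=
  forall x, exists l : seq X, [/\ uniq l, size l = q.+1 & forall y, adj x y <-> y \in l].

(* graph distance *)
Definition gdist (x y : X) : nat :=
  xget 0%N [set n | (exists p, walk x y p /\ size p = n.+1) /\
                    forall p, walk x y p -> (n.+1 <= size p)%N].

(* directed edges are pairs (iota e, tau e) = (e.1, e.2);
   chains are indexed by nat: c n = e_{n+1} *)
Definition is_fch (c : nat -> X * X) :=
  forall n, [/\ adj (c n).1 (c n).2, (c n).2 = (c n.+1).1 & (c n.+1).2 <> (c n).1].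
Definition is_bch (c : nat -> X * X) :=
  forall n, [/\ adj (c n).1 (c n).2, (c n.+1).2 = (c n).1 & (c n.+1).1 <> (c n).2].

(* eventually equal up to an index shift *)
Definition ch_eq (c c' : nat -> X * X) := exists k l, forall n, c (n + k)%N = c' (n + l)%N.

(* the boundary: equivalence classes of forward chains *)
Definition Omega :=
  {S : set (nat -> X * X) | exists c, is_fch c /\ S = [set c' | is_fch c' /\ ch_eq c c']}.

(* partial_+ e *)
Definition dplus (e : X * X) (w : Omega) := exists c, sval w c /\ c 0%N = e.
(* basis of the topology: finite intersections of the sets partial_+ e *)
Definition OmB : set (set Omega) :=
  [set b | exists l : seq (X * X), b = [set w | forall e, e \in l -> dplus e w]].

(* bi-infinite geodesics *)
Definition is_line (g : int -> X) := forall i : int, adj (g i) (g (i + 1)) /\ g (i + 2) <> g i.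
Definition fwd_of (g : int -> X) : nat -> X * X := fun n => (g n%:Z, g (n%:Z + 1)).
Definition bwd_rev_of (g : int -> X) : nat -> X * X := fun n => (g (- n%:Z), g (- n%:Z - 1)).
(* ]w', w[ : vertex set of the geodesic from w' to w *)
Definition geod (w' w : Omega) (x : X) :=
  exists g, [/\ is_line g, sval w (fwd_of g), sval w' (bwd_rev_of g) & exists i, g i = x].

(* vertex set of the ray [x, w) *)
Definition ray_set (x : X) (w : Omega) :=
  [set v | exists c, [/\ sval w c, (c 0%N).1 = x & exists n, (c n).1 = v]].

Variable o : X.
(* horocycle bracket <x, w> *)
Definition horo (x : X) (w : Omega) : int :=
  xget 0 [set k : int | exists y, ray_set o w `&` ray_set x w = ray_set y w /\
                                  k = (gdist o y)%:Z - (gdist x y)%:Z].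

(* q^z := exp (z log q) *)
Definition cpowq (z : C) : C :=
  (expR (complex.Re z * ln (q%:R : R)))%:C *
  ((cos (complex.Im z * ln (q%:R : R)))%:C + 'i * (sin (complex.Im z * ln (q%:R : R)))%:C).

(* p_s(x, w) = q^((1/2 + i s) <x, w>) *)
Definition ps (s : C) (x : X) (w : Omega) : C := cpowq ((2%:R^-1 + 'i * s) * (horo x w)%:~R).

Definition chi (s : C) : C :=
  ((Num.sqrt (q%:R : R)) / (q.+1)%:R)%:C * (cpowq ('i * s) + cpowq (- ('i * s))).

Definition Lap (f : X -> C) (x : X) : C :=
  ((q.+1)%:R)^-1 * \sum_(y \in [set y | adj x y]) f y.

(* distributions on Omega: algebraic dual of locally constant functions *)
Definition LCO (f : Omega -> C) := loc_const OmB setT f.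
Definition distO (mu : (Omega -> C) -> C) := alg_dual LCO setT mu.
(* mu is the boundary value mu_{s,phi}: P_s mu = phi *)
Definition is_bv (s : C) (phi : X -> C) (mu : (Omega -> C) -> C) :=
  distO mu /\ forall x, mu (fun w => ps s x w) = phi x.
Definition conj_dist (mu : (Omega -> C) -> C) : (Omega -> C) -> C :=
  fun f => (mu (fun w => (f w)^*))^*.

(* the space P of triples ((w', w), x) *)
Definition inP (p : Omega * Omega * X) := p.1.1 <> p.1.2 /\ geod p.1.1 p.1.2 p.2.
Definition PB : set (set (Omega * Omega * X)) :=
  [set b | exists b1 b2 x, [/\ OmB b1, OmB b2 &
             b = [set p | [/\ b1 p.1.1, b2 p.1.2 & p.2 = x]]]].

(* group actions *)
Definition act (g : X -> X) (c : nat -> X * X) : nat -> X * X :=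
  fun n => (g (c n).1, g (c n).2).
Definition actO (g : X -> X) (w w' : Omega) := forall c, sval w c -> sval w' (act g c).
Definition actP (g : X -> X) (p p' : Omega * Omega * X) :=
  [/\ actO g p.1.1 p'.1.1, actO g p.1.2 p'.1.2 & p'.2 = g p.2].

Variable Gam : set (X -> X).

Definition is_aut (g : X -> X) := bijective g /\ forall x y, adj x y <-> adj (g x) (g y).
Definition aut_subgroup :=
  [/\ forall g, Gam g -> is_aut g, Gam id,
      forall g h, Gam g -> Gam h -> Gam (g \o h) &
      forall g, Gam g -> exists h, [/\ Gam h, cancel g h & cancel h g]].
(* discrete for the topology of pointwise convergence on Aut *)
Definition discrete_grp :=
  exists S : seq X, forall g, Gam g -> (forall x, x \in S -> g x = x) -> g = id.
Definition acts_freely := forall g x, Gam g -> g x = x -> g = id.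
Definition finite_quotient := exists S : seq X, forall x, exists g y, [/\ Gam g, y \in S & x = g y].

Definition Gam_inv (phi : X -> C) := forall g x, Gam g -> phi (g x) = phi x.

(* C^lc(P_Gamma) *)
Definition test_PG (F : Omega * Omega * X -> C) :=
  loc_const PB inP F /\ forall g p p', Gam g -> inP p -> actP g p p' -> F p' = F p.

(* Xi (g p) *)
Definition val_at (Xi : Omega * Omega * X -> C) (g : X -> X) (p : Omega * Omega * X) : C :=
  xget 0 [set v | exists p', actP g p p' /\ v = Xi p'].

Definition cutoff_P (Xi : Omega * Omega * X -> C) :=
  test_fun PB inP Xi /\
  forall p, inP p -> exists l : list (X -> X),
    [/\ List.NoDup l, forall g, List.In g l -> Gam g,
        forall g, Gam g -> val_at Xi g p <> 0 -> List.In g l &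
        \sum_(g <- l) val_at Xi g p = 1].

(* Patterson-Sullivan distribution *)
Definition PS_integrand (s s' : C) (XiP F : Omega * Omega * X -> C) (w' w : Omega) : C :=
  if `[< w = w' >] then 0 else
  \sum_(x \in geod w' w) XiP (w', w, x) * F (w', w, x) * ps s x w * ps (- s'^*) x w'.
Definition PS (s s' : C) (mu mu' : (Omega -> C) -> C) (XiP F : Omega * Omega * X -> C) : C :=
  mu (fun w => conj_dist mu' (fun w' => PS_integrand s s' XiP F w' w)).

(* shift spaces: cylinder sets *)
Definition cylB : set (set (nat -> X * X)) :=
  [set b | exists (n : nat) (e : nat -> X * X), b = [set c | forall i, (i < n)%N -> c i = e i]].

Definition Lplus (f : (nat -> X * X) -> C) (c : nat -> X * X) : C :=
  \sum_(w \in [set w | adj w (c 0%N).1 /\ w <> (c 0%N).2])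
     f (fun n => if n is k.+1 then c k else (w, (c 0%N).1)).
Definition Lminus (f : (nat -> X * X) -> C) (c : nat -> X * X) : C :=
  \sum_(w \in [set w | adj (c 0%N).2 w /\ w <> (c 0%N).1])
     f (fun n => if n is k.+1 then c k else ((c 0%N).2, w)).

(* U in E_s(L'_{+}) with pi_{+,*} U = phi *)
Definition is_preim_plus (s : C) (phi : X -> C) (U : ((nat -> X * X) -> C) -> C) :=
  [/\ alg_dual (test_fun cylB is_fch) is_fch U,
      forall f, test_fun cylB is_fch f -> U (Lplus f) = cpowq (2%:R^-1 + 'i * s) * U f &
      forall x, U (fun c => ((c 0%N).1 == x)%:R) = phi x].
Definition is_preim_minus (s : C) (phi : X -> C) (U : ((nat -> X * X) -> C) -> C) :=
  [/\ alg_dual (test_fun cylB is_bch) is_bch U,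
      forall f, test_fun cylB is_bch f -> U (Lminus f) = cpowq (2%:R^-1 + 'i * s) * U f &
      forall x, U (fun c => ((c 0%N).2 == x)%:R) = phi x].

Definition cutoff_pm (D : set (nat -> X * X)) (Xi : (nat -> X * X) -> C) :=
  test_fun cylB D Xi /\
  forall c, D c -> exists l : list (X -> X),
    [/\ List.NoDup l, forall g, List.In g l -> Gam g,
        forall g, Gam g -> Xi (act g c) <> 0 -> List.In g l &
        \sum_(g <- l) Xi (act g c) = 1].

(* I_{+-}(s)(phi) = (F |-> U((F o pr) Xi)) *)
Definition Ipm (U : ((nat -> X * X) -> C) -> C) (Xi : (nat -> X * X) -> C) :
  ((nat -> X * X) -> C) -> C := fun G => U (fun c => G c * Xi c).

(* p = (w', w, x) corresponds to the pair ([x, w), p_-) *)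
Definition emb (p : Omega * Omega * X) (cp cm : nat -> X * X) :=
  exists g, [/\ is_line g, sval p.1.2 (fwd_of g), sval p.1.1 (bwd_rev_of g) & g 0 = p.2] /\
            cp = fwd_of g /\ cm = (fun n : nat => (g (- (n%:Z + 1)), g (- n%:Z))).

(* F on P_Gamma extended by zero to P^+_Gamma x P^-_Gamma *)
Definition extz (F : Omega * Omega * X -> C) (cp cm : nat -> X * X) : C :=
  xget 0 [set v | exists p g1 g2,
     [/\ Gam g1, Gam g2, inP p, emb p (act g1 cp) (act g2 cm) & v = F p]].

Definition tensorG (up um : ((nat -> X * X) -> C) -> C)
  (Phi : (nat -> X * X) -> (nat -> X * X) -> C) : C :=
  up (fun cp => um (fun cm => Phi cp cm)).
End Tree.

(* Main.v *)
(** For an edge [(x, y)] and a boundary point beyond it, the horocycle bracket grows by one from [x]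
to [y]; hence the functionals [N_x f = mu (p_s(x, .) f)] satisfy [N_y f = z N_x f] for [f] supported
beyond [(x, y)], where [z = q^(1/2 + i s)].  The functionals [N_x f = U (f on the chains starting
at x)] attached to [U] in [E_s(L'_+)] obey the same rule, because a shadow seen from [y] is the image
under the transfer operator of the same shadow seen from [x].  In both cases [N_x 1 = phi x].  If
[z^2 <> 1], which is what [chi(s) <> 1, -1] says, such a family is unique: for the difference of two
families the two shadows of an edge give a nondegenerate 2x2 linear system, so all shadows have
measure zero, and a fan argument passes from shadows to locally constant functions.  Uniqueness also
gives the [Gamma]-equivariance of the families.  Both sides of the theorem then unfold, the cutoffs
summing to one along [Gamma]-orbits, to the sum over representatives [x] of the vertex orbits of
[N_x (x) N'_x] applied to [F] at the geodesics through [x]. *)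
Require Import Defs.
From HB Require Import structures.
From mathcomp Require Import all_boot all_order all_algebra.
From mathcomp Require Import all_classical all_reals all_analysis.
From mathcomp Require Import complex.
From mathcomp Require Import zify ring.
Set Implicit Arguments. Unset Strict Implicit. Unset Printing Implicit Defensive.
Import GRing.Theory Num.Theory ComplexField.
Local Open Scope classical_set_scope.
Local Open Scope ring_scope.
Local Open Scope complex_scope.

Section Chains.
Variables (X : choiceType) (adj : X -> X -> Prop).
Hypothesis tree : is_tree adj.
Local Notation chain := (nat -> X * X).
Local Notation Om := (@Omega X adj).

Lemma adj_sym x y : adj x y -> adj y x.
Proof. by case: tree => H _ _; exact: H. Qed.

Definition fcons (e : X * X) (c : chain) : chain := fun n => if n is k.+1 then c k else e.

Lemma fch_shift c k : is_fch adj c -> is_fch adj (fun n => c (n + k)%N).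
Proof. by move=> Hc n; have := Hc (n + k)%N; rewrite addSn. Qed.

Lemma fch_fcons a c : is_fch adj c -> adj a (c 0%N).1 -> a <> (c 0%N).2 ->
  is_fch adj (fcons (a, (c 0%N).1) c).
Proof.
by move=> Hc Ha Hn [|n] /=; [split => // /esym | exact: Hc].
Qed.

Lemma fch_reduced c n : is_fch adj c ->
  reduced_walk adj (c 0%N).1 (c n).1 (mkseq (fun i => (c i).1) n.+1).
Proof.
move=> Hc; split; first split.
- by rewrite size_mkseq.
- by [].
- by rewrite -nth_last size_mkseq nth_mkseq.
- rewrite size_mkseq => i Hi; rewrite !nth_mkseq //; last exact: ltnW.
  by have [Ha <- _] := Hc i.
- rewrite size_mkseq => i Hi; rewrite !nth_mkseq //; last by do 2!apply: ltnW.
  have [_ _ H1] := Hc i; have [_ H2 _] := Hc i.+1.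
  by rewrite -H2.
Qed.

Lemma fch_agree c c' k l : is_fch adj c -> is_fch adj c' -> (c 0%N).1 = (c' 0%N).1 ->
  (c k).1 = (c' l).1 -> k = l /\ forall i, (i <= k)%N -> (c i).1 = (c' i).1.
Proof.
move=> Hc Hc' H0 Hkl; have Hw := fch_reduced k Hc; have := fch_reduced l Hc'.
rewrite -H0 -Hkl => Hw'.
have [_ _ /(_ (c 0%N).1 (c k).1) [p [_ Hp]]] := tree.
have E : mkseq (fun i => (c i).1) k.+1 = mkseq (fun i => (c' i).1) l.+1.
  by rewrite -(Hp _ Hw) -(Hp _ Hw').
have Ekl : k = l by move/(congr1 size): E; rewrite !size_mkseq => -[].
split=> // i Hi; move/(congr1 (fun s => nth (c 0%N).1 s i)): E.
by rewrite !nth_mkseq -?Ekl.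
Qed.

Lemma fch_inj c k l : is_fch adj c -> (c k).1 = (c l).1 -> k = l.
Proof. by move=> Hc /(fch_agree Hc Hc erefl) []. Qed.

Lemma fch_ext c c' : is_fch adj c -> is_fch adj c' ->
  (forall n, (c n).1 = (c' n).1) -> c = c'.
Proof.
move=> Hc Hc' H; apply/funext => n; have [_ E _] := Hc n; have [_ E' _] := Hc' n.
by rewrite (surjective_pairing (c n)) (surjective_pairing (c' n)) H E E' H.
Qed.

Lemma fch_ch_eq c c' : is_fch adj c -> is_fch adj c' -> (c 0%N).1 = (c' 0%N).1 ->
  ch_eq c c' -> c = c'.
Proof.
move=> Hc Hc' H0 [k [l H]]; apply: fch_ext => // n.
by have [_ ->//] := fch_agree Hc Hc' H0 (congr1 fst (H n)); exact: leq_addr.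
Qed.

Lemma ch_eq_refl (c : chain) : ch_eq c c.
Proof. by exists 0%N, 0%N. Qed.

Lemma ch_eq_sym (c c' : chain) : ch_eq c c' -> ch_eq c' c.
Proof. by move=> [k [l H]]; exists l, k => n; rewrite H. Qed.

Lemma ch_eq_trans (c1 c2 c3 : chain) : ch_eq c1 c2 -> ch_eq c2 c3 -> ch_eq c1 c3.
Proof.
move=> [k [l H]] [k' [l' H']]; exists (k + k')%N, (l' + l)%N => n.
by rewrite (addnC k) addnA H addnAC H' -!addnA (addnC l).
Qed.

Lemma ch_eq_shift (c : chain) k : ch_eq c (fun n => c (n + k)%N).
Proof. by exists k, 0%N => n; rewrite addn0. Qed.

Lemma ch_eq_fcons e (c : chain) : ch_eq c (fcons e c).
Proof. by exists 0%N, 1%N => n; rewrite addn0 addn1. Qed.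

Definition end_of (c : chain) (Hc : is_fch adj c) : Om :=
  exist _ [set c' | is_fch adj c' /\ ch_eq c c'] (ex_intro _ c (conj Hc erefl)).

Lemma end_of_mem c (Hc : is_fch adj c) : sval (end_of Hc) c.
Proof. by split => //; exact: ch_eq_refl. Qed.

Lemma Omega_fch (w : Om) c : sval w c -> is_fch adj c.
Proof. by case: w => S [c0 [H0 ES]] /=; rewrite ES => -[]. Qed.

Lemma Omega_ch_eq (w : Om) c c' : sval w c -> sval w c' -> ch_eq c c'.
Proof.
case: w => S [c0 [H0 ES]] /=; rewrite ES => -[_ H1] [_ H2].
exact: ch_eq_trans (ch_eq_sym H1) H2.
Qed.

Lemma Omega_closed (w : Om) c c' : sval w c -> is_fch adj c' -> ch_eq c c' -> sval w c'.
Proof.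
case: w => S [c0 [H0 ES]] /=; rewrite ES => -[_ H1] Hc' H2.
by split=> //; exact: ch_eq_trans H1 H2.
Qed.

Lemma Omega_inhab (w : Om) : exists c, sval w c.
Proof. by case: w => S [c0 [H0 ES]] /=; exists c0; rewrite ES; split=> //; exact: ch_eq_refl. Qed.

Lemma Omega_eq (w w' : Om) c : sval w c -> sval w' c -> w = w'.
Proof.
move=> H H'; suff E : sval w = sval w'.
  by case: w w' E {H H'} => S HS [S' HS'] /= E; exact: eq_exist.
apply/seteqP; split => c' Hc'.
  by apply: Omega_closed H' (Omega_fch Hc') _; exact: Omega_ch_eq H Hc'.
by apply: Omega_closed H (Omega_fch Hc') _; exact: Omega_ch_eq H' Hc'.
Qed.

Lemma adj_connected (P : X -> Prop) x y :
  (forall a b, adj a b -> P a -> P b) -> P x -> P y.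
Proof.
move=> HP Px; have [_ _ /(_ x y) [p [[[Hs H0 Hl Hadj] _] _]]] := tree.
have H i : (i < size p)%N -> P (nth x p i).
  elim: i => [_|i IH Hi]; first by rewrite H0.
  by apply: (HP _ _ (Hadj i Hi)); apply: IH; exact: ltnW.
by rewrite -Hl -nth_last; apply: H; rewrite ltn_predL.
Qed.

Definition ray (x : X) (w : Om) : chain :=
  xget (fun=> (x, x)) [set c | sval w c /\ (c 0%N).1 = x].

Definition nxt (x : X) (w : Om) : X := (ray x w 0%N).2.

Lemma ray_spec x (w : Om) : sval w (ray x w) /\ (ray x w 0%N).1 = x.
Proof.
suff H : exists c, [set c | sval w c /\ (c 0%N).1 = x] c by have := xgetPex (fun=> (x, x)) H.
have [c Hc] := Omega_inhab w.
apply: (@adj_connected (fun y => exists c, sval w c /\ (c 0%N).1 = y) (c 0%N).1); last by exists c.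
move=> a b Hab [{}c [{}Hc Ea]]; rewrite -{}Ea in Hab.
have [E|N] := pselect (b = (c 0%N).2).
  exists (fun n => c (n + 1)%N); split; last by have [_ E' _] := Omega_fch Hc 0%N; rewrite E E'.
  apply: (Omega_closed Hc); first exact: fch_shift (Omega_fch Hc).
  exact: ch_eq_shift.
exists (fcons (b, (c 0%N).1) c); split=> //.
apply: (Omega_closed Hc); last exact: ch_eq_fcons.
by apply: fch_fcons (Omega_fch Hc) _ N; exact: adj_sym.
Qed.

Lemma ray_mem x w : sval w (ray x w).
Proof. by have [] := ray_spec x w. Qed.

Lemma ray_start x w : (ray x w 0%N).1 = x.
Proof. by have [] := ray_spec x w. Qed.

Lemma ray_fch x w : is_fch adj (ray x w).
Proof. exact: Omega_fch (ray_mem x w). Qed.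

Lemma ray_uniq x (w : Om) c : sval w c -> (c 0%N).1 = x -> ray x w = c.
Proof.
move=> Hc E; apply: fch_ch_eq; [exact: ray_fch|exact: Omega_fch Hc|by rewrite ray_start|].
exact: Omega_ch_eq (ray_mem x w) Hc.
Qed.

Lemma ray0 x w : ray x w 0%N = (x, nxt x w).
Proof. by rewrite (surjective_pairing (ray x w 0%N)) ray_start. Qed.

Lemma ray_shift x w k n : ray (ray x w k).1 w n = ray x w (n + k)%N.
Proof.
rewrite (@ray_uniq (ray x w k).1 w (fun n => ray x w (n + k)%N)) //.
apply: (Omega_closed (ray_mem x w)); first exact: fch_shift (ray_fch x w).
exact: ch_eq_shift.
Qed.

Lemma ray_link x w n : (ray x w n).2 = (ray x w n.+1).1.
Proof. by have [] := ray_fch x w n. Qed.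

Lemma ray_nxt x w n : ray (nxt x w) w n = ray x w n.+1.
Proof. by rewrite /nxt ray_link ray_shift addn1. Qed.

Lemma nxt_adj x w : adj x (nxt x w).
Proof. by have [H _ _] := ray_fch x w 0%N; rewrite ray_start in H. Qed.

Lemma nxt_nobacktrack x w : nxt (nxt x w) w <> x.
Proof. by have [_ _] := ray_fch x w 0%N; rewrite ray_start -ray_nxt. Qed.

Lemma ray_extend x y w : adj x y -> nxt y w <> x -> ray x w = fcons (x, y) (ray y w).
Proof.
move=> Hxy Hn; apply: ray_uniq => //.
apply: (Omega_closed (ray_mem y w)); last exact: ch_eq_fcons.
have := @fch_fcons x _ (ray_fch y w); rewrite ray_start; apply => // E.
by apply: Hn; rewrite E.
Qed.

Lemma nxt_extend x y w : adj x y -> nxt y w <> x -> nxt x w = y.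
Proof. by move=> H1 H2; rewrite {1}/nxt (ray_extend H1 H2). Qed.

Lemma dplusE x y w : dplus (x, y) w <-> nxt x w = y.
Proof.
split=> [[c [Hc E]]|<-]; first by rewrite /nxt (ray_uniq Hc) E.
by exists (ray x w); split; [exact: ray_mem|exact: ray0].
Qed.

Lemma nxt_opp x y w : adj x y -> (nxt y w = x <-> nxt x w <> y).
Proof.
move=> H; split=> [E1 E2|N]; last exact: nxt_extend (adj_sym H) N.
by apply: (@nxt_nobacktrack x w); rewrite E2.
Qed.

Lemma dplus_fch c m (w : Om) : is_fch adj c -> dplus (c m) w ->
  forall n, (n <= m)%N -> dplus (c n) w.
Proof.
move=> Hc Hm; have Hstep n : dplus (c n.+1) w -> dplus (c n) w.
  rewrite (surjective_pairing (c n)) (surjective_pairing (c n.+1)) !dplusE => E.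
  have [H1 H2 H3] := Hc n; rewrite H2 in H1 *; apply: nxt_extend => // E'.
  by apply: H3; rewrite -E.
move=> n Hn; rewrite -(subKn Hn); elim: (m - n)%N => [|k IH]; first by rewrite subn0.
have [E|Hk] := leqP m k; first by move: IH; rewrite (eqP E) (eqP (leqW E)).
by apply: Hstep; rewrite -subSn // subSS.
Qed.

Lemma dplus_OmB e : OmB [set w : Om | dplus e w].
Proof.
exists [:: e]; apply/seteqP; split=> w /= H; last by apply: H; rewrite mem_head.
by move=> e'; rewrite inE => /eqP ->.
Qed.

Lemma OmB_setI (b1 b2 : set Om) : OmB b1 -> OmB b2 -> OmB (b1 `&` b2).
Proof.
move=> [l1 ->] [l2 ->]; exists (l1 ++ l2); apply/seteqP; split=> w /=.
  by move=> [H1 H2] e; rewrite mem_cat => /orP[/H1|/H2].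
by move=> H; split=> e He; apply: H; rewrite mem_cat He ?orbT.
Qed.

Lemma OmB_setT : OmB [set: Om].
Proof. by exists [::]; apply/seteqP; split=> w. Qed.

Lemma OmB_fch (b : set Om) w c : OmB b -> b w -> sval w c ->
  exists n, forall m, (n <= m)%N -> forall w', dplus (c m) w' -> b w'.
Proof.
move=> [l ->] /= Hl Hc; elim: l Hl => [|e l IH] Hl; first by exists 0%N.
have [|n1 H1] := IH; first by move=> e' He'; apply: Hl; rewrite inE He' orbT.
have [|c' [Hc' E']] := Hl e; first by rewrite mem_head.
have [k [l' H]] := Omega_ch_eq Hc Hc'.
exists (maxn n1 k) => m; rewrite geq_max => /andP[Hm1 Hmk] w' Hw' e'.
rewrite inE => /orP[/eqP->|]; last exact: H1 Hm1 _ Hw' _.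
rewrite -E'; apply: (@dplus_fch _ (m - k + l')%N) => //; first exact: Omega_fch Hc'.
by rewrite -H subnK.
Qed.

Lemma ray_cont x w w' n : dplus (ray x w n) w' ->
  forall i, (i <= n)%N -> ray x w' i = ray x w i.
Proof.
move=> H; have Hd := dplus_fch (ray_fch x w) H; elim=> [H0|i IH Hi].
  by have := Hd _ H0; rewrite ray0 dplusE => E; rewrite ray0 E.
have := Hd _ Hi; rewrite (surjective_pairing (ray x w i.+1)) dplusE => <-.
have -> : (ray x w i.+1).1 = (ray x w' i.+1).1.
  by rewrite -!ray_link IH // ltnW.
by rewrite -ray0 ray_shift.
Qed.

(* The fan theorem: an edge violating [good] would start an infinite chain of such edges. *)
Lemma edge_fan (good : X * X -> Prop) :
  (forall a b, adj a b -> (forall c, adj b c -> c <> a -> good (b, c)) -> good (a, b)) ->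
  (forall c, is_fch adj c -> exists n, good (c n)) ->
  forall a b, adj a b -> good (a, b).
Proof.
move=> Hstep Hbar a b Hab; apply: contrapT => Hbad.
pose bad (e : X * X) := adj e.1 e.2 /\ ~ good e.
have Hnext e : {e' | bad e -> [/\ bad e', e.2 = e'.1 & e'.2 <> e.1]}.
  apply: cid; have [[He1 He2]|N] := pselect (bad e); last by exists e => /N.
  case: e He1 He2 => x y /= He1 He2.
  have [z Hz] : exists z, [/\ adj y z, z <> x & ~ good (y, z)].
    apply: contrapT => Hno; apply: He2; apply: Hstep => // z Hz Hzx.
    by apply: contrapT => Hg; apply: Hno; exists z.
  by case: Hz => Hz1 Hz2 Hz3; exists (y, z) => _.
pose c n := iter n (fun e => sval (Hnext e)) (a, b).
have Hc n : bad (c n) by elim: n => [//|n IH] /=; case: (svalP (Hnext (c n)) IH).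
have Hch : is_fch adj c.
  by move=> n; have [H1 H2 H3] := svalP (Hnext (c n)) (Hc n); split => //; case: (Hc n).
by have [n Hn] := Hbar c Hch; case: (Hc n).
Qed.

Lemma line_through (w' w : Om) x : nxt x w <> nxt x w' ->
  exists g, [/\ is_line adj g, fwd_of g = ray x w & bwd_rev_of g = ray x w'].
Proof.
move=> Hn.
pose g (i : int) := match i with Posz n => (ray x w n).1 | Negz n => (ray x w' n.+1).1 end.
have gN n : g (- n%:Z) = (ray x w' n).1.
  by case: n => [|n]; rewrite ?oppr0 /= ?ray_start // -NegzE.
have Hw : fwd_of g = ray x w.
  apply/funext => n; rewrite /fwd_of; have -> : n%:Z + 1 = n.+1%:Z by lia.
  by rewrite /= -ray_link -surjective_pairing.
have Hw' : bwd_rev_of g = ray x w'.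
  apply/funext => n; rewrite /bwd_rev_of; have -> : - n%:Z - 1 = - n.+1%:Z by lia.
  by rewrite !gN -ray_link -surjective_pairing.
exists g; split=> //.
case=> n.
  have [H1 H2 H3] := ray_fch x w n; have -> : n%:Z + 1 = n.+1%:Z by lia.
  have -> : n%:Z + 2 = n.+2%:Z by lia.
  by rewrite /= -!ray_link; split.
have -> : Negz n = - n.+1%:Z by lia.
have -> : - n.+1%:Z + 1 = - n%:Z by lia.
have [H1 H2 H3] := ray_fch x w' n.
split; first by rewrite !gN -ray_link; exact: adj_sym.
case: n H1 H2 H3 => [|n] H1 H2 H3.
  by rewrite gN /= -!ray_link -/(nxt x w) -/(nxt x w').
have -> : - n.+2%:Z + 2 = - n%:Z by lia.
rewrite !gN => E; have [_ _] := ray_fch x w' n.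
by rewrite E ray_link.
Qed.

Lemma geodE (w' w : Om) x : geod w' w x <-> nxt x w <> nxt x w'.
Proof.
split=> [[g [Hg Hw Hw' [i Hi]]]|/line_through [g [Hg Hw Hw']]]; last first.
  exists g; split; rewrite ?Hw ?Hw' //; try exact: ray_mem.
  by exists 0; move/(congr1 (fun c => (c 0%N).1)): Hw; rewrite ray_start.
have E1 : ray x w = (fun n : nat => (g (i + n%:Z), g (i + n%:Z + 1))).
  apply: ray_uniq; last by rewrite /= addr0.
  apply: (Omega_closed Hw).
    move=> n /=; have [H1 H2] := Hg (i + n%:Z); split => //=.
      by congr g; lia.
    by have -> : i + n.+1%:Z + 1 = i + n%:Z + 2 by lia.
  case: i {Hi} => i; first by exists i, 0%N => n; rewrite /fwd_of /= addn0; congr (g _, g _); lia.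
  by exists 0%N, i.+1 => n; rewrite /fwd_of /= addn0; congr (g _, g _); lia.
have E2 : ray x w' = (fun n : nat => (g (i - n%:Z), g (i - n%:Z - 1))).
  apply: ray_uniq; last by rewrite /= subr0.
  apply: (Omega_closed Hw').
    move=> n /=; have [H1 _] := Hg (i - n%:Z - 1); have [_ H2] := Hg (i - n%:Z - 2).
    split => /=; first by apply: adj_sym; move: H1; rewrite subrK.
      by congr g; lia.
    move=> E; apply: H2; have -> : i - n%:Z - 2 + 2 = i - n%:Z by lia.
    by rewrite -E; congr g; lia.
  case: i {Hi E1} => i; first by exists 0%N, i => n; rewrite /bwd_rev_of /= addn0; congr (g _, g _); lia.
  by exists i.+1, 0%N => n; rewrite /bwd_rev_of /= addn0; congr (g _, g _); lia.
rewrite /nxt E1 E2 /= !addr0; have [_] := Hg (i - 1).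
by have -> : i - 1 + 2 = i + 1 by lia.
Qed.

Lemma geod_neq (w' w : Om) x : geod w' w x -> w' <> w.
Proof. by move=> /geodE H E; apply: H; rewrite E. Qed.

Lemma inPE (p : Om * Om * X) : inP p <-> nxt p.2 p.1.2 <> nxt p.2 p.1.1.
Proof. by split=> [[_ /geodE]//|/geodE H]; split=> //; exact: geod_neq H. Qed.

End Chains.

Section Horocycles.
Variables (X : choiceType) (adj : X -> X -> Prop).
Hypothesis tree : is_tree adj.
Local Notation Om := (@Omega X adj).

Lemma ray_setE x (w : Om) v : ray_set x w v <-> exists n, (ray x w n).1 = v.
Proof.
split=> [[c [Hc H0 [n Hn]]]|[n Hn]]; first by exists n; rewrite (ray_uniq tree Hc H0).
by exists (ray x w); split; [exact: ray_mem|exact: ray_start|exists n].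
Qed.

Definition busemann (w : Om) (x y : X) (z : int) : Prop :=
  exists k l, (forall n, ray x w (n + k)%N = ray y w (n + l)%N) /\ z = k%:Z - l%:Z.

Lemma busemann_ex w x y : exists z, busemann w x y z.
Proof.
have [k [l H]] := Omega_ch_eq (ray_mem tree x w) (ray_mem tree y w).
by exists (k%:Z - l%:Z), k, l.
Qed.

Lemma busemann_uniq w x y z z' : busemann w x y z -> busemann w x y z' -> z = z'.
Proof.
move=> [k [l [H ->]]] [k' [l' [H' ->]]].
have E : ray y w (k' + l)%N = ray y w (k + l')%N by rewrite -H -H' addnC.
have := fch_inj tree (ray_fch tree y w) (congr1 fst E); lia.
Qed.

Lemma busemann_nxt w x y z : busemann w x y z -> busemann w x (nxt y w) (z + 1).
Proof.
move=> [k [l [H ->]]]; exists k.+1, l; split; last by lia.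
by move=> n; rewrite ray_nxt // -addSn -H addnS.
Qed.

Lemma busemann_ray w x n : busemann w x (ray x w n).1 n%:Z.
Proof.
by exists n, 0%N; split=> [m|]; [rewrite ray_shift // addn0|rewrite subr0].
Qed.

Lemma busemann_walk w x y p z : walk adj x y p -> busemann w x y z -> z < (size p)%:Z.
Proof.
move=> [Hs H0 Hl Hadj] Hz.
have H i : (i < size p)%N -> forall z', busemann w x (nth x p i) z' -> z' <= i%:Z.
  elim: i => [_|i IH Hi] z'.
    by rewrite H0 => H; rewrite (busemann_uniq H (y := x) (z' := 0)) //; exists 0%N, 0%N.
  have [z1 Hz1] := busemann_ex w x (nth x p i).
  have := IH (ltnW Hi) _ Hz1 => Hle Hz'.
  have [E|N] := pselect (nxt (nth x p i) w = nth x p i.+1).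
    have := busemann_nxt Hz1; rewrite E => /(busemann_uniq Hz'); lia.
  have E := proj2 (nxt_opp tree w (Hadj i Hi)) N.
  have := busemann_nxt Hz'; rewrite E => /(busemann_uniq Hz1); lia.
have := H (size p).-1; rewrite nth_last Hl ltn_predL => /(_ Hs _ Hz); lia.
Qed.

Lemma gdist_ray (w : Om) x n : gdist adj x (ray x w n).1 = n.
Proof.
have Hw : walk adj x (ray x w n).1 (mkseq (fun i => (ray x w i).1) n.+1).
  by have [+ _] := fch_reduced n (ray_fch tree x w); rewrite ray_start.
have Hmin p : walk adj x (ray x w n).1 p -> (n.+1 <= size p)%N.
  by move=> /busemann_walk /(_ (busemann_ray w x n)); lia.
apply: xget_unique; first by split=> //; eexists; split; [exact: Hw|rewrite size_mkseq].
move=> m [[p [Hp Es]] Hm]; apply/eqP; rewrite eqn_leq.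
by have := Hmin _ Hp; have := Hm _ Hw; rewrite Es size_mkseq !ltnS => -> ->.
Qed.

Lemma horo_busemann o (w : Om) x z : busemann w o x z -> horo o x w = z.
Proof.
move=> Hz; have Hval y : ray_set o w `&` ray_set x w = ray_set y w ->
    (gdist adj o y)%:Z - (gdist adj x y)%:Z = z.
  move=> E; have : ray_set y w y by apply/ray_setE; exists 0%N; rewrite ray_start.
  rewrite -E => -[/ray_setE [i Hi] /ray_setE [j Hj]].
  rewrite -{1}Hi -Hj !gdist_ray; apply: busemann_uniq Hz.
  by exists i, j; split=> // n; rewrite -!ray_shift // Hi Hj.
rewrite /horo.
suff [y Hy] : exists y, ray_set o w `&` ray_set x w = ray_set y w.
  by apply: xget_unique => [|k [y' [Hy' ->]]]; [exists y; split=> //; rewrite Hval|exact: Hval].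
have Hex : exists i, `[< ray_set x w (ray o w i).1 >].
  have [k [l [H _]]] := Hz; exists k; apply/asboolP/ray_setE.
  by exists l; rewrite -(H 0%N).
case: (ex_minnP Hex) => i /asboolP /ray_setE [j Hj] Hmin.
exists (ray o w i).1; apply/seteqP; split=> v.
  move=> [/ray_setE [m Hm] Hv]; apply/ray_setE.
  have Him : (i <= m)%N by apply: Hmin; apply/asboolP; rewrite Hm.
  by exists (m - i)%N; rewrite ray_shift // subnK.
move/ray_setE => [m Hm]; split; apply/ray_setE.
  by exists (m + i)%N; rewrite -ray_shift.
by exists (m + j)%N; rewrite -ray_shift // Hj.
Qed.

Lemma horo_nxt o (w : Om) x : horo o (nxt x w) w = horo o x w + 1.
Proof.
have [z Hz] := busemann_ex w o x.
by rewrite (horo_busemann Hz) (horo_busemann (busemann_nxt Hz)).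
Qed.
End Horocycles.

Section ComplexPowers.
Variables (R : realType) (q : nat).
Local Notation C := R[i].

Lemma cpowqE (z : C) : cpowq q z =
  (expR (complex.Re z * ln (q%:R : R)) * cos (complex.Im z * ln (q%:R : R))) +i*
  (expR (complex.Re z * ln (q%:R : R)) * sin (complex.Im z * ln (q%:R : R))).
Proof. by apply/eqP; rewrite eq_complex /=; apply/andP; split; apply/eqP; ring. Qed.

Lemma cpowqD (a b : C) : cpowq q (a + b) = cpowq q a * cpowq q b.
Proof.
rewrite !cpowqE; case: a b => [a1 a2] [b1 b2] /=; rewrite !mulrDl expRD cosD sinD.
by apply/eqP; rewrite eq_complex /=; apply/andP; split; apply/eqP; ring.
Qed.

Lemma cpowq0 : cpowq q 0 = 1 :> C.
Proof. by rewrite cpowqE /= !mul0r expR0 cos0 sin0 mulr1 mulr0. Qed.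

Lemma cpowqN (a : C) : cpowq q a * cpowq q (- a) = 1.
Proof. by rewrite -cpowqD subrr cpowq0. Qed.

Lemma cpowq_neq0 (a : C) : cpowq q a != 0.
Proof.
by apply/eqP => E; have := cpowqN a; rewrite E mul0r => /eqP; rewrite eq_sym oner_eq0.
Qed.

Lemma cpowq_conj (a : C) : (cpowq q a)^* = cpowq q a^*.
Proof. by rewrite !cpowqE; case: a => [a1 a2] /=; rewrite mulNr cosN sinN mulrN. Qed.

Lemma cpowq_half : (0 < q)%N -> cpowq q (2%:R^-1) = (Num.sqrt (q%:R : R))%:C.
Proof.
move=> Hq; have Eh : (2%:R^-1 : C) = (2%:R^-1 : R)%:C by rewrite fmorphV /= rmorph_nat.
rewrite Eh cpowqE /= mul0r cos0 sin0 mulr1 mulr0; congr (_ +i* _).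
have Hq' : 0 < (q%:R : R) by rewrite ltr0n.
apply/esym; rewrite -[RHS]gtr0_norm ?expR_gt0 // -sqrtr_sqr; congr Num.sqrt.
by rewrite -expRM_natl mulrA mulfV ?mul1r ?lnK.
Qed.

Lemma chi_sqr_neq1 (s : C) : (1 < q)%N -> chi q s <> 1 -> chi q s <> -1 ->
  cpowq q (2%:R^-1 + 'i * s) ^+ 2 != 1.
Proof.
move=> Hq H1 H2; apply/negP; rewrite cpowqD cpowq_half ?(ltnW Hq) //.
set r := Num.sqrt _; set u := cpowq q ('i * s).
have Hr2 : (r%:C * r%:C : C) = q%:R.
  by rewrite -rmorphM /= -expr2 sqr_sqrtr ?ler0n // rmorph_nat.
have Hq1 : (q.+1%:R : C) != 0 by rewrite pnatr_eq0.
have EV : (q.+1%:R^-1 : R)%:C = (q.+1%:R^-1 : C) by rewrite fmorphV /= rmorph_nat.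
have Hinv : cpowq q (- ('i * s)) = u^-1.
  have := cpowqN ('i * s); rewrite -/u => E.
  by rewrite -[LHS](mulKf (cpowq_neq0 ('i * s))) -/u E mulr1.
have Hsgn e : e * e = 1 -> r%:C * u = e -> chi q s = e.
  move=> He Hu; have Hu0 : u != 0 := cpowq_neq0 _.
  have Hr0 : r%:C != 0 :> C.
    by apply/eqP => E; move: Hr2; rewrite E mul0r => /esym/eqP; rewrite pnatr_eq0; case: q Hq.
  rewrite /chi Hinv -/u -/r rmorphM /= EV.
  have -> : u^-1 = r%:C * e.
    apply: (mulfI Hu0); rewrite mulfV // mulrA (mulrC u) Hu He //.
  rewrite -mulrA mulrCA mulrDr Hu mulrA Hr2 -{1}[e]mul1r -mulrDl addrC natr1.
  by rewrite mulKf.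
rewrite sqrf_eq1 => /orP[] /eqP Hu.
  by apply: H1; apply: Hsgn => //; rewrite mulr1.
by apply: H2; apply: Hsgn => //; rewrite mulrNN mulr1.
Qed.

End ComplexPowers.

Definition lin_closed (R : realType) (T : Type) (V : (T -> R[i]) -> Prop) :=
  V (fun=> 0) /\ forall a f g, V f -> V g -> V (fun x => a * f x + g x).

Section AlgebraicDual.
Variables (R : realType) (T : Type) (V : (T -> R[i]) -> Prop) (D : set T).
Variable u : (T -> R[i]) -> R[i].
Hypotheses (HV : lin_closed V) (Hu : alg_dual V D u).

Lemma dual_add f g : V f -> V g -> u (fun x => f x + g x) = u f + u g.
Proof.
move=> Hf Hg; have [H _] := Hu; have := H 1 _ _ Hf Hg; rewrite mul1r => <-.
by congr u; apply/funext => x; rewrite mul1r.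
Qed.

Lemma dual0 : u (fun=> 0) = 0.
Proof.
have := dual_add (proj1 HV) (proj1 HV); have -> : (fun _ : T => 0 + 0 : R[i]) = (fun=> 0) by apply/funext => x; rewrite addr0.
by move/eqP; rewrite eq_sym -subr_eq0 addrK => /eqP.
Qed.

Lemma dual_scale a f : V f -> u (fun x => a * f x) = a * u f.
Proof.
move=> Hf; have [H _] := Hu; have := H a _ _ Hf (proj1 HV); rewrite dual0 addr0 => <-.
by congr u; apply/funext => x; rewrite addr0.
Qed.

Lemma closed_sum (I : eqType) (s : seq I) (P : pred I) (F : I -> T -> R[i]) :
  (forall i, i \in s -> P i -> V (F i)) -> V (fun x => \sum_(i <- s | P i) F i x).
Proof.
case: HV => V0 Vlin; elim: s => [|i s IH] H.
  by have -> : (fun x => \sum_(i <- [::] | P i) F i x) = (fun=> 0)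
    by apply/funext => x; rewrite big_nil.
have Hs : V (fun x => \sum_(i <- s | P i) F i x).
  by apply: IH => j Hj; apply: H; rewrite inE Hj orbT.
case HP : (P i).
  have -> : (fun x => \sum_(j <- i :: s | P j) F j x) = (fun x => 1 * F i x + \sum_(j <- s | P j) F j x).
    by apply/funext => x; rewrite big_cons HP mul1r.
  by apply: Vlin => //; apply: H => //; exact: mem_head.
have -> // : (fun x => \sum_(j <- i :: s | P j) F j x) = (fun x => \sum_(j <- s | P j) F j x).
by apply/funext => x; rewrite big_cons HP.
Qed.

Lemma dual_sum (I : eqType) (s : seq I) (P : pred I) (F : I -> T -> R[i]) :
  (forall i, i \in s -> P i -> V (F i)) ->
  u (fun x => \sum_(i <- s | P i) F i x) = \sum_(i <- s | P i) u (F i).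
Proof.
elim: s => [|i s IH] H.
  by rewrite big_nil -[RHS]dual0; congr u; apply/funext => x; rewrite big_nil.
have H' j : j \in s -> P j -> V (F j) by move=> Hj; apply: H; rewrite inE Hj orbT.
rewrite big_cons -IH //; case HP : (P i); last first.
  by congr u; apply/funext => x; rewrite big_cons HP.
rewrite -dual_add; first by congr u; apply/funext => x; rewrite big_cons HP.
  by apply: H => //; exact: mem_head.
exact: closed_sum.
Qed.
End AlgebraicDual.

Section LocallyConstant.
Variables (R : realType) (q : nat) (X : choiceType) (adj : X -> X -> Prop).
Hypotheses (tree : is_tree adj) (reg : regular_deg q adj).
Local Notation Om := (@Omega X adj).
Local Notation C := R[i].
Local Notation LCO := (@LCO R X adj).

Definition loc_const_map (A : Type) (f : Om -> A) :=
  forall w, exists b, OmB b /\ b w /\ forall w', b w' -> f w' = f w.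

Lemma LCO_loc_const_map (f : Om -> C) : LCO f <-> loc_const_map f.
Proof.
split=> H w; first by have [//|b [Hb [Hw H']]] := H w; exists b; do ?split=> //; move=> w'; exact: H'.
by move=> _; have [b [Hb [Hw H']]] := H w; exists b; do ?split=> //; move=> w' _; exact: H'.
Qed.

Lemma LCO_comp (A : Type) (h : A -> C) (f : Om -> A) :
  loc_const_map f -> LCO (fun w => h (f w)).
Proof.
move=> H; apply/LCO_loc_const_map => w; have [b [Hb [Hw H']]] := H w.
by exists b; do ?split=> //; move=> w' /H' ->.
Qed.

Lemma LCO_op2 (h : C -> C -> C) f g : LCO f -> LCO g -> LCO (fun w => h (f w) (g w)).
Proof.
move=> Hf Hg w _; have [//|b [Hb [Hw H]]] := Hf w; have [//|b' [Hb' [Hw' H']]] := Hg w.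
exists (b `&` b'); split; first exact: OmB_setI.
by split=> // w' _ [H1 H2]; rewrite H // H'.
Qed.

Lemma LCO_cst (a : C) : LCO (fun=> a).
Proof. by move=> w _; exists setT; split; [exact: OmB_setT|split]. Qed.

Lemma LCO_lin a f g : LCO f -> LCO g -> LCO (fun w => a * f w + g w).
Proof. exact: (LCO_op2 (fun x y => a * x + y)). Qed.

Lemma LCO_closed : lin_closed LCO.
Proof. by split; [exact: LCO_cst|exact: LCO_lin]. Qed.

Lemma LCO_mul f g : LCO f -> LCO g -> LCO (fun w => f w * g w).
Proof. exact: (LCO_op2 (fun x y => x * y)). Qed.

Lemma ray_loc_const x n : loc_const_map (fun w => ray x w n).
Proof.
move=> w; exists [set w' | dplus (ray x w n) w']; split; first exact: dplus_OmB.
split=> [|w' Hw']; last exact: (ray_cont tree Hw').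
by rewrite /= (surjective_pairing (ray x w n)) dplusE // /nxt ray_shift.
Qed.

Lemma nxt_loc_const x : loc_const_map (nxt x).
Proof.
by move=> w; have [b [Hb [Hw H]]] := ray_loc_const x 0 w; exists b; do ?split=> //;
  move=> w' /H; rewrite /nxt => ->.
Qed.

Lemma horo_loc_const o x : loc_const_map (horo o x).
Proof.
move=> w; have [k [l H]] := Omega_ch_eq (ray_mem tree o w) (ray_mem tree x w).
have [b [Hb [Hw E]]] := ray_loc_const o k w; have [b' [Hb' [Hw' E']]] := ray_loc_const x l w.
exists (b `&` b'); split; first exact: OmB_setI.
split=> // w' [/E H1 /E' H2].
have Hb1 : busemann w o x (k%:Z - l%:Z) by exists k, l.
suff Hb2 : busemann w' o x (k%:Z - l%:Z) by rewrite !(horo_busemann tree Hb1, horo_busemann tree Hb2).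
by exists k, l; split=> // n; rewrite -!ray_shift // H1 H2 (H 0%N).
Qed.

Lemma LCO_ps o s x : LCO (fun w => ps q o s x w).
Proof. by apply: (LCO_comp (fun k : int => cpowq q ((2%:R^-1 + 'i * s) * k%:~R))); exact: horo_loc_const. Qed.

Lemma OmB_finite (l : seq X) (Q : X -> Om -> Prop) w :
  (forall c, c \in l -> exists b, [/\ OmB b, b w & forall u, b u -> Q c u]) ->
  exists b, [/\ OmB b, b w & forall u, b u -> forall c, c \in l -> Q c u].
Proof.
elim: l => [|c l IH] H; first by exists setT; split=> //; exact: OmB_setT.
have [|b [Hb Hw HQ]] := IH; first by move=> c' Hc'; apply: H; rewrite inE Hc' orbT.
have [|b' [Hb' Hw' HQ']] := H c; first exact: mem_head.
exists (b `&` b'); split=> //; first exact: OmB_setI.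
by move=> u [Hu Hu'] c'; rewrite inE => /orP[/eqP->|]; [exact: HQ'|exact: HQ].
Qed.

Definition LCO2 (K : Om -> Om -> C) := forall w' w, exists b1 b2,
  [/\ OmB b1, OmB b2, b1 w', b2 w & forall u' u, b1 u' -> b2 u -> K u' u = K w' w].

Lemma LCO2_op2 (h : C -> C -> C) K L : LCO2 K -> LCO2 L -> LCO2 (fun w' w => h (K w' w) (L w' w)).
Proof.
move=> HK HL w' w; have [b1 [b2 [H1 H2 H3 H4 E]]] := HK w' w.
have [c1 [c2 [H1' H2' H3' H4' E']]] := HL w' w.
exists (b1 `&` c1), (b2 `&` c2); split => //; try exact: OmB_setI.
by move=> u' u [? ?] [? ?]; rewrite E // E'.
Qed.

Lemma LCO2_lin a K L : LCO2 K -> LCO2 L -> LCO2 (fun w' w => a * K w' w + L w' w).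
Proof. exact: (LCO2_op2 (fun x y => a * x + y)). Qed.

Lemma LCO2_mul K L : LCO2 K -> LCO2 L -> LCO2 (fun w' w => K w' w * L w' w).
Proof. exact: (LCO2_op2 (fun x y => x * y)). Qed.

Lemma LCO2_cst (a : C) : LCO2 (fun _ _ => a).
Proof. by move=> w' w; exists setT, setT; split => //; exact: OmB_setT. Qed.

Lemma LCO2_closed : lin_closed (fun f : Om * Om -> C => LCO2 (fun w' w => f (w', w))).
Proof. by split=> [|a f g]; [exact: LCO2_cst|exact: LCO2_lin]. Qed.

Lemma LCO2_l K w : LCO2 K -> LCO (fun w' => K w' w).
Proof. by move=> HK w' _; have [b1 [b2 [? ? ? ? E]]] := HK w' w; exists b1; do ?split=> //; move=> u' _ ?; exact: E. Qed.

Lemma LCO2_unif K w : LCO2 K ->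
  exists b, [/\ OmB b, b w & forall u, b u -> forall u', K u' u = K u' w].
Proof.
move=> HK.
pose good (e : X * X) := exists b, [/\ OmB b, b w & forall u, b u -> forall u', dplus e u' -> K u' u = K u' w].
have Hgood : forall x y, adj x y -> good (x, y).
  apply: edge_fan => [a b Hab Hc|c Hc].
    have [l [_ _ Hl]] := reg b.
    have [|b' [Hb' Hw H]] := @OmB_finite (rem a (undup l)) (fun c u => forall u', dplus (b, c) u' -> K u' u = K u' w) w.
      move=> c; rewrite mem_rem_uniq ?undup_uniq // inE mem_undup => /andP[/eqP Hca Hcl].
      by apply: Hc => //; apply/Hl.
    exists b'; split=> // u Hu u' /(dplusE tree) Hu'.
    apply: (H u Hu (nxt b u')); last by apply/(dplusE tree).
    rewrite mem_rem_uniq ?undup_uniq // inE mem_undup; apply/andP; split; last by apply/Hl; exact: nxt_adj.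
    by apply/eqP => E; exact: (proj1 (nxt_opp tree _ Hab) E Hu').
  have [b1 [b2 [H1 H2 H3 H4 E]]] := HK (end_of Hc) w.
  have [n Hn] := OmB_fch tree H1 H3 (end_of_mem Hc).
  by exists n, b2; split=> // u Hu u' /Hn Hu'; rewrite !E //; exact: Hu'.
have [c _] := Omega_inhab w; pose x := (c 0%N).1; have [l [_ _ Hl]] := reg x.
have [|b [Hb Hw H]] := @OmB_finite l (fun y u => forall u', dplus (x, y) u' -> K u' u = K u' w) w.
  by move=> y /Hl; exact: Hgood.
exists b; split=> // u Hu u'; apply: (H u Hu (nxt x u')); last by apply/(dplusE tree).
by apply/Hl; exact: nxt_adj.
Qed.

Lemma LCO2_dual K (N : (Om -> C) -> C) : LCO2 K -> LCO (fun w => N (fun w' => K w' w)).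
Proof.
move=> HK w _; have [b [Hb Hw H]] := LCO2_unif w HK; exists b; do ?split=> //.
by move=> u _ Hu; congr N; apply/funext => u'; exact: H.
Qed.
End LocallyConstant.

Section Eigenfamilies.
Variables (R : realType) (q : nat) (X : choiceType) (adj : X -> X -> Prop).
Hypotheses (tree : is_tree adj) (reg : regular_deg q adj).
Local Notation Om := (@Omega X adj).
Local Notation C := R[i].
Local Notation LCO := (@LCO R X adj).

(* The common shape of the functionals [f |-> mu (p_s(x, .) f)] and
   [f |-> U (f restricted to the chains starting at x)], with [z = q^(1/2 + i s)]. *)
Definition eigenfamily (z : C) (phi : X -> C) (N : X -> (Om -> C) -> C) :=
  [/\ forall x, distO (N x),
      forall x y f, adj x y -> LCO f -> (forall w, nxt x w <> y -> f w = 0) ->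
        N y f = z * N x f
    & forall x, N x (fun=> 1) = phi x].

Lemma LCO_ind x y : LCO (fun w : Om => (nxt x w == y)%:R).
Proof. by apply: (LCO_comp (fun v => (v == y)%:R)); exact: nxt_loc_const. Qed.

Lemma sum_ind (l : seq X) x (w : Om) : uniq l -> (forall y, adj x y <-> y \in l) ->
  \sum_(y <- l) (nxt x w == y)%:R = 1 :> C.
Proof.
move=> Hu Hl; have Hx : nxt x w \in l by apply/Hl; exact: nxt_adj.
rewrite (bigD1_seq (nxt x w)) //= eqxx big1 ?addr0 // => y /negPf.
by rewrite eq_sym => ->.
Qed.

Lemma eigenfamily0 (z : C) N : z != 0 -> z ^+ 2 != 1 -> eigenfamily z (fun=> 0) N ->
  forall x f, LCO f -> N x f = 0.
Proof.
move=> Hz0 Hz [HN Hsh H1].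
have Hsum x := dual_sum (@LCO_closed R X adj) (HN x).
have Hscale x := dual_scale (@LCO_closed R X adj) (HN x).
have Hind x y : adj x y -> N x (fun w => (nxt x w == y)%:R) = 0.
  move=> Hxy; have Hyx := adj_sym tree Hxy.
  have H01 v : N v (fun w => (nxt x w == y)%:R) + N v (fun w => (nxt y w == x)%:R) = 0.
    rewrite -(H1 v) -(dual_add (HN v)) //; try exact: LCO_ind.
    congr N; apply/funext => w; have [E|E] := eqVneq (nxt x w) y.
      by case: eqVneq => [/(nxt_opp tree _ Hxy)/(_ E)[]|_]; rewrite addr0.
    by rewrite (proj2 (nxt_opp tree _ Hxy)) ?eqxx ?add0r //; exact/eqP.
  have := H01 y; rewrite (Hsh x y) //; [|exact: LCO_ind|by move=> w /eqP/negPf ->].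
  have := H01 x; rewrite (Hsh y x (fun w => (nxt y w == x)%:R)) //; [|exact: LCO_ind|by move=> w /eqP/negPf ->].
  set A := N x _; set B := N y _ => E1 E2.
  have : (1 - z ^+ 2) * A = 0.
    have -> : (1 - z ^+ 2) * A = (A + z * B) - z * (z * A + B) by ring.
    by rewrite E1 E2 mulr0 subr0.
  by move/eqP; rewrite mulf_eq0 subr_eq0 eq_sym (negPf Hz) => /eqP.
move=> x f Hf.
pose good (e : X * X) := N e.1 (fun w => f w * (nxt e.1 w == e.2)%:R) = 0.
have Hgood : forall a b, adj a b -> good (a, b).
  apply: edge_fan => [a b Hab Hc|c Hc]; rewrite /good /=.
    apply/eqP; rewrite -(mulrI_eq0 _ (lregP Hz0)) -(Hsh a b) //; first last.
    - by move=> w /eqP/negPf ->; rewrite mulr0.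
    - exact: LCO_mul Hf (LCO_ind a b).
    have [l [Hu _ Hl]] := reg b.
    have -> : (fun w => f w * (nxt a w == b)%:R) =
              (fun w => \sum_(c <- l | c != a) f w * (nxt b w == c)%:R).
      apply/funext => w; rewrite -mulr_sumr; congr (_ * _).
      have Ha : a \in l by apply/Hl; exact: adj_sym.
      have := sum_ind w Hu Hl; rewrite (bigD1_seq a Ha Hu) /=.
      move/(canRL (addKr _)) => ->.
      have [E|E] := eqVneq (nxt a w) b.
        by case: eqVneq => [/(nxt_opp tree _ Hab)/(_ E)[]|_]; rewrite oppr0 add0r.
      by rewrite (proj2 (nxt_opp tree _ Hab)) ?eqxx ?addNr //; exact/eqP.
    rewrite Hsum; last by move=> c _ _; exact: LCO_mul Hf (LCO_ind b c).
    rewrite big_seq_cond big1 // => c /andP[/Hl Hbc /eqP Hca]; exact: Hc.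
  have [//|b [Hb [Hw Hfb]]] := Hf (end_of Hc).
  have [n Hn] := OmB_fch tree Hb Hw (end_of_mem Hc).
  exists n; have -> : (fun w => f w * (nxt (c n).1 w == (c n).2)%:R) =
    (fun w => f (end_of Hc) * (nxt (c n).1 w == (c n).2)%:R).
    apply/funext => w; case: eqVneq => [E|]; rewrite ?mulr0 // Hfb //.
    by apply: (Hn n) => //; rewrite (surjective_pairing (c n)); apply/dplusE.
  by rewrite Hscale ?Hind ?mulr0 //; [case: (Hc n)|exact: LCO_ind].
have [l [Hu _ Hl]] := reg x.
have -> : f = (fun w => \sum_(y <- l) f w * (nxt x w == y)%:R).
  by apply/funext => w; rewrite -mulr_sumr sum_ind ?mulr1.
rewrite Hsum; last by move=> c _ _; exact: LCO_mul Hf (LCO_ind x c).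
by rewrite big_seq big1 // => y /Hl; exact: Hgood.
Qed.

Lemma eigenfamily_uniq z phi N N' : z != 0 -> z ^+ 2 != 1 ->
  eigenfamily z phi N -> eigenfamily z phi N' -> forall x f, LCO f -> N x f = N' x f.
Proof.
move=> Hz0 Hz [HN Hsh H1] [HN' Hsh' H1'] x f Hf; apply/eqP; rewrite -subr_eq0; apply/eqP.
apply: (eigenfamily0 Hz0 Hz (N := fun x f => N x f - N' x f)) => //; split=> [y|y v g Hyv Hg Hs|y].
- split=> [a g h Hg Hh|g h Hg Hh E].
    by rewrite (proj1 (HN y)) // (proj1 (HN' y)) // mulrBr addrACA opprD.
  by rewrite (proj2 (HN y) g h) // (proj2 (HN' y) g h).
- by rewrite (Hsh y v) // (Hsh' y v) // mulrBr.
- by rewrite H1 H1' subrr.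
Qed.

Lemma eigenfamily_conj z phi N : eigenfamily z phi N ->
  eigenfamily z^* (fun x => (phi x)^*) (fun x f => (N x (fun w => (f w)^*))^*).
Proof.
move=> [HN Hsh H1].
have Hc f : LCO f -> LCO (fun w => (f w)^*).
  by move=> Hf; apply: (LCO_comp (fun a : C => a^*)); apply/LCO_loc_const_map.
split=> [x|x y f Hxy Hf Hs|x].
- split=> [a f g Hf Hg|f g Hf Hg E].
    rewrite -[a in RHS]conjcK -rmorphM -rmorphD /= -(proj1 (HN x)); try exact: Hc.
    by congr (N x _)^*; apply/funext => w; rewrite rmorphD rmorphM.
  by congr (_^*); congr (N x _); apply/funext => w; rewrite E.
- rewrite -rmorphM /= -(Hsh x y) //; first exact: Hc.
  by move=> w /Hs ->; exact: rmorph0.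
- rewrite -H1; congr (_^*); congr (N x _); apply/funext => w; exact: rmorph1.
Qed.

Lemma eigenfamily_bv o s phi mu : is_bv q o s phi mu ->
  eigenfamily (cpowq q (2%:R^-1 + 'i * s)) phi (fun x f => mu (fun w => ps q o s x w * f w)).
Proof.
move=> [[Hlin Hext] Hphi].
have Hps x f : LCO f -> LCO (fun w => ps q o s x w * f w) by move=> Hf; apply: LCO_mul => //; exact: LCO_ps.
split=> [x|x y f Hxy Hf Hs|x].
- split=> [a f g Hf Hg|f g Hf Hg E].
    rewrite -Hlin; try exact: Hps.
    by congr mu; apply/funext => w; ring.
  by congr mu; apply/funext => w; rewrite E.
- rewrite -(dual_scale (@LCO_closed R X adj) (conj Hlin Hext)); last exact: Hps.
  congr mu; apply/funext => w; have [E|N] := pselect (nxt x w = y); last by rewrite Hs // !mulr0.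
  by rewrite /ps -E horo_nxt // intrD mulrDr mulr1 cpowqD; ring.
- by rewrite -Hphi; congr mu; apply/funext => w; rewrite mulr1.
Qed.

End Eigenfamilies.

Section TestFunctions.
Variables (R : realType) (X : choiceType).
Local Notation chain := (nat -> X * X).
Local Notation C := R[i].

Lemma test_fun_ext (T : Type) (B : set (set T)) D (f g : T -> C) :
  test_fun B D f -> (forall x, D x -> f x = g x) -> test_fun B D g.
Proof.
move=> [Hl [K [HKD [HK Hs]]]] E; split.
  move=> x Hx; have [b [Hb [Hbx H]]] := Hl x Hx; exists b; do ?split=> //.
  by move=> y Hy Hby; rewrite -!E // H.
by exists K; do ?split=> //; move=> x Hx; rewrite -E //; exact: Hs.
Qed.

Lemma b_compactU (T : Type) (B : set (set T)) (K L : set T) :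
  b_compact B K -> b_compact B L -> b_compact B (K `|` L).
Proof.
move=> HK HL I V HV Hc; have [|l Hl] := HK I V HV; first by move=> x Hx; apply: Hc; left.
have [|l' Hl'] := HL I V HV; first by move=> x Hx; apply: Hc; right.
exists (l ++ l')%list => x [/Hl|/Hl'] [i [Hi Hx]]; exists i; split=> //; apply/List.in_or_app.
  by left.
by right.
Qed.

Lemma test_fun_cylB_closed (D : set chain) : lin_closed (test_fun (R := R) (@cylB X) D).
Proof.
split=> [|a f g [Hf [K [HKD [HK Hs]]]] [Hg [L [HLD [HL Hs']]]]].
  split=> [c Hc|].
    by exists [set c' | forall i, (i < 0)%N -> c' i = c i]; do ?split=> //; exists 0%N, c.
  by exists set0; do ?split=> //; move=> I V HV _; exists nil => x [].
split=> [c Hc|].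
  have [_ [[n [e ->]] [/= He E]]] := Hf c Hc; have [_ [[m [e' ->]] [/= He' E']]] := Hg c Hc.
  exists [set c' | forall i, (i < maxn n m)%N -> c' i = c i]; split; first by exists (maxn n m), c.
  split=> // c' Hc' Heq; rewrite (E c') // ?(E' c') // => i Hi.
    by rewrite Heq ?He' // leq_max Hi orbT.
  by rewrite Heq ?He // leq_max Hi.
exists (K `|` L); split; first by move=> x [/HKD|/HLD].
split; first exact: b_compactU.
move=> x Hx N; have [E|Nf] := pselect (f x = 0); last by left; exact: Hs.
have [E'|Ng] := pselect (g x = 0); last by right; exact: Hs'.
by case: N; rewrite E E' mulr0 addr0.
Qed.

Lemma undup_list_In (I : eqType) (L : list I) i : List.In i L -> i \in undup L.
Proof.
rewrite mem_undup; elim: L => [//|j L IH] [->|/IH H]; first exact: mem_head.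
by rewrite inE H orbT.
Qed.

Lemma list_finite (I T : Type) (l : seq X) (Q : X -> T -> Prop) (W : I -> T -> Prop) :
  (forall c, c \in l -> exists L, forall w, Q c w -> exists i, List.In i L /\ W i w) ->
  exists L, forall c, c \in l -> forall w, Q c w -> exists i, List.In i L /\ W i w.
Proof.
elim: l => [|c l IH] H; first by exists nil.
have [|L HL] := IH; first by move=> c' Hc'; apply: H; rewrite inE Hc' orbT.
have [|L' HL'] := H c; first exact: mem_head.
exists (L' ++ L)%list => c'; rewrite inE => /orP[/eqP->|Hc'] w.
  by move=> /HL' [i [Hi Hw]]; exists i; split=> //; apply/List.in_or_app; left.
by move=> /(HL _ Hc') [i [Hi Hw]]; exists i; split=> //; apply/List.in_or_app; right.
Qed.

Definition rev_chain (c : chain) : chain := fun n => ((c n).2, (c n).1).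

Lemma rev_chainK : involutive rev_chain.
Proof. by move=> c; apply/funext => n; rewrite /rev_chain /= -surjective_pairing. Qed.

Lemma cylB_rev b : cylB b -> cylB (rev_chain @^-1` b).
Proof.
move=> [n [e ->]]; exists n, (rev_chain e); apply/seteqP; split=> c /= H i Hi.
  by rewrite /rev_chain -(H i Hi) /rev_chain -surjective_pairing.
by rewrite /rev_chain (H i Hi) /rev_chain -surjective_pairing.
Qed.

Lemma test_fun_rev (D D' : set chain) (f : chain -> C) : (forall c, D c <-> D' (rev_chain c)) ->
  test_fun (@cylB X) D' f -> test_fun (@cylB X) D (fun c => f (rev_chain c)).
Proof.
move=> HD [Hl [K [HKD [HK Hs]]]]; split.
  move=> c /HD Hc; have [b [Hb [Hbx H]]] := Hl _ Hc.
  exists (rev_chain @^-1` b); split; first exact: cylB_rev.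
  by split=> // c' /HD; exact: H.
exists (rev_chain @^-1` K); split; first by move=> c /HKD/HD.
split; last by move=> c /HD; exact: Hs.
move=> I V HV Hc.
have [i c /HV [b [Hb [Hbc Hs']]]||l Hl'] := HK I (fun i => rev_chain @^-1` V i).
- exists (rev_chain @^-1` b); split; first exact: cylB_rev.
  by split=> // c' /Hs'.
- by move=> c Hc'; apply: Hc; rewrite /= rev_chainK.
by exists l => c /Hl'; rewrite /= rev_chainK.
Qed.
End TestFunctions.

Section ChainFunctionals.
Variables (R : realType) (q : nat) (X : choiceType) (adj : X -> X -> Prop).
Hypotheses (tree : is_tree adj) (reg : regular_deg q adj).
Local Notation Om := (@Omega X adj).
Local Notation C := R[i].
Local Notation LCO := (@LCO R X adj).
Local Notation chain := (nat -> X * X).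
Local Notation testF := (test_fun (R := R) (@cylB X) (is_fch adj)).

Definition lift_at (x : X) (f : Om -> C) (c : chain) : C :=
  if (c 0%N).1 == x then xget 0 [set v | exists w, sval w c /\ v = f w] else 0.

Lemma lift_atE x f w c : sval w c -> lift_at x f c = if (c 0%N).1 == x then f w else 0.
Proof.
move=> Hw; rewrite /lift_at; case: eqP => // _; apply: xget_unique; first by exists w.
by move=> _ [w' [Hw' ->]]; rewrite (Omega_eq Hw' Hw).
Qed.

Lemma dplus_mem (w : Om) c n : sval w c -> dplus (c n) w.
Proof.
move=> Hc; exists (fun m => c (m + n)%N); split=> //.
by apply: (Omega_closed Hc); [exact: fch_shift (Omega_fch Hc)|exact: ch_eq_shift].
Qed.

Lemma compact_start x : b_compact (@cylB X) [set c | is_fch adj c /\ (c 0%N).1 = x].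
Proof.
move=> I V HV Hcov; have [l [_ _ Hl]] := reg x.
pose good (e : X * X) := exists L : list I, forall w : Om, dplus e w ->
  exists i, List.In i L /\ V i (ray x w).
have Hgood : forall a b, adj a b -> good (a, b).
  apply: edge_fan => // [a b Hab Hc|c Hc].
    have [m [_ _ Hm]] := reg b.
    have [|L HL] := @list_finite _ _ Om (rem a (undup m)) (fun c w => dplus (b, c) w) (fun i w => V i (ray x w)).
      move=> c; rewrite mem_rem_uniq ?undup_uniq // inE mem_undup => /andP[/eqP Hca /Hm].
      by move=> Hbc; exact: Hc.
    exists L => w /(dplusE tree) Hw; apply: (HL (nxt b w)); last by apply/dplusE.
    rewrite mem_rem_uniq ?undup_uniq // inE mem_undup; apply/andP; split; last by apply/Hm; exact: nxt_adj.
    by apply/eqP => E; exact: (proj1 (nxt_opp tree _ Hab) E Hw).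
  pose w := end_of Hc; have [|i Hi] := Hcov (ray x w).
    by split; [exact: ray_fch|exact: ray_start].
  have [_ [[n [e ->]] [/= He Hs]]] := HV i _ Hi.
  have [|||m Hm] := @OmB_fch _ _ tree [set w' | dplus (ray x w n) w'] w c.
  - exact: dplus_OmB.
  - exact: dplus_mem (ray_mem tree x w).
  - exact: end_of_mem.
  exists m, [:: i] => w' /(Hm m (leqnn m)) /= Hw'; exists i; split; first by left.
  by apply: Hs => j Hj /=; rewrite (ray_cont tree Hw') ?He // ltnW.
have [|L HL] := @list_finite _ _ Om l (fun c w => dplus (x, c) w) (fun i w => V i (ray x w)).
  by move=> c /Hl; exact: Hgood.
exists L => c [Hc Hx]; rewrite -(ray_uniq tree (end_of_mem Hc) Hx).
apply: (HL (nxt x (end_of Hc))); last by apply/dplusE.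
by apply/Hl; exact: nxt_adj.
Qed.

Lemma lift_at_test x f : LCO f -> testF (lift_at x f).
Proof.
move=> Hf; split.
  move=> c Hc; have [//|b [Hb [Hw H]]] := Hf (end_of Hc).
  have [n Hn] := OmB_fch tree Hb Hw (end_of_mem Hc).
  exists [set c' | forall i, (i < n.+1)%N -> c' i = c i]; split; first by exists n.+1, c.
  split=> // c' Hc' E; rewrite (lift_atE _ _ (end_of_mem Hc)) (lift_atE _ _ (end_of_mem Hc')).
  rewrite (E 0%N) //; case: eqP => // _; apply: H => //; apply: (Hn n) => //.
  by rewrite -E //; exact: dplus_mem (end_of_mem Hc').
exists [set c | is_fch adj c /\ (c 0%N).1 = x]; split; first by move=> c [].
split; first exact: compact_start.
by move=> c Hc; rewrite /lift_at; case: eqP.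
Qed.

Lemma test_fun_ray f x : testF f -> LCO (fun w => f (ray x w)).
Proof.
move=> [Hf _] w _; have [_ [[n [e ->]] [/= He H]]] := Hf _ (ray_fch tree x w).
exists [set w' | dplus (ray x w n) w']; split; first exact: dplus_OmB.
split; first exact: dplus_mem (ray_mem tree x w).
move=> w' _ Hw'; apply: H; first exact: ray_fch.
by move=> i Hi; rewrite (ray_cont tree Hw') ?He // ltnW.
Qed.

Lemma test_fun_support f : testF f ->
  exists S, uniq S /\ forall c, is_fch adj c -> f c <> 0 -> (c 0%N).1 \in S.
Proof.
move=> [_ [K [_ [HK Hs]]]].
have [x c /= Hc|c _|L HL] := HK X (fun x => [set c | (c 0%N).1 = x]).
- exists [set c' | forall i, (i < 1)%N -> c' i = c i]; split; first by exists 1%N, c.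
  by split=> // c' /= /(_ 0%N erefl) ->.
- by exists (c 0%N).1.
exists (undup L); split; first exact: undup_uniq.
by move=> c Hc /(Hs c Hc)/HL [x [Hx /= ->]]; exact: undup_list_In.
Qed.

Section Functional.
Variable U : (chain -> C) -> C.
Hypothesis HU : alg_dual testF (is_fch adj) U.

Lemma chain_dual_sum (S : seq X) f : uniq S ->
  (forall x, x \in S -> LCO (fun w => f (ray x w))) ->
  (forall c, is_fch adj c -> f c <> 0 -> (c 0%N).1 \in S) ->
  U f = \sum_(x <- S) U (lift_at x (fun w => f (ray x w))).
Proof.
move=> HS Hf Hs; have Ht x : x \in S -> true -> testF (lift_at x (fun w => f (ray x w))).
  by move=> Hx _; exact: lift_at_test (Hf x Hx).
rewrite -(dual_sum (test_fun_cylB_closed R _) HU Ht).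
have Hsum := closed_sum (test_fun_cylB_closed R _) Ht.
have E c : is_fch adj c -> \sum_(x <- S) lift_at x (fun w => f (ray x w)) c = f c.
  move=> Hc; have El x : lift_at x (fun w => f (ray x w)) c = if (c 0%N).1 == x then f c else 0.
    by rewrite (lift_atE _ _ (end_of_mem Hc)); case: eqP => // /(ray_uniq tree (end_of_mem Hc)) ->.
  under eq_bigr do rewrite El.
  have [H0|/Hs Hx] := pselect (f c = 0); first by rewrite big1 // => x _; rewrite H0; case: ifP.
  rewrite (bigD1_seq (c 0%N).1) ?Hx //= eqxx big1 ?addr0 // => x.
  by rewrite eq_sym => /negPf ->.
apply: (proj2 HU) => //; last by move=> c Hc; rewrite E.
by apply: test_fun_ext Hsum _.
Qed.
End Functional.

Lemma eigenfamily_chain s phi U : is_preim_plus q adj s phi U ->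
  eigenfamily (cpowq q (2%:R^-1 + 'i * s)) phi (fun x f => U (lift_at x f)).
Proof.
move=> [HU HL Hphi].
split=> [x|x y f Hxy Hf Hs|x].
- split=> [a f g Hf Hg|f g Hf Hg E]; last by congr U; congr lift_at; apply/funext => w; exact: E.
  have Ef := lift_at_test x Hf; have Eg := lift_at_test x Hg.
  rewrite -(proj1 HU) //; apply: (proj2 HU).
  + by apply: lift_at_test; exact: LCO_lin.
  + exact: (proj2 (test_fun_cylB_closed _ _)).
  + move=> c Hc; rewrite !(lift_atE _ _ (end_of_mem Hc)); case: eqP => // _.
    by rewrite mulr0 addr0.
- rewrite -HL; last exact: lift_at_test.
  have Ey c : is_fch adj c -> lift_at y f c = Lplus adj (lift_at x f) c.
    move=> Hc; rewrite (lift_atE _ _ (end_of_mem Hc)) /Lplus; set w := end_of Hc.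
    have Hr : c = ray (c 0%N).1 w by rewrite (ray_uniq tree (end_of_mem Hc)).
    have Hn : nxt (c 0%N).1 w = (c 0%N).2 by rewrite /nxt -Hr.
    have [[Ha Hb]|N] := pselect (adj x (c 0%N).1 /\ x <> (c 0%N).2).
      have Hx : sval w (fcons (x, (c 0%N).1) c).
        apply: (Omega_closed (end_of_mem Hc)); last exact: ch_eq_fcons.
        exact: fch_fcons.
      rewrite -(@fsbig_widen _ _ _ _ [set x]); first last.
      + by move=> v [_ /= Hv]; rewrite /lift_at /=; case: eqP.
      + by move=> v ->.
      rewrite fsbig_set1 (lift_atE _ _ Hx) /= eqxx; case: eqP => // Hy.
      apply/esym/Hs; rewrite (@nxt_extend _ _ tree x (c 0%N).1) //; last by rewrite Hn => E; apply: Hb.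
    rewrite fsbig1; last first.
      by move=> v /= Hv; rewrite /lift_at /=; case: eqP => // E; case: N; rewrite -E.
    case: eqP => // Ec; apply: Hs => E; apply: N; rewrite Ec; split=> // Ex.
    by rewrite Ec -Ex in Hn; apply: (proj1 (nxt_opp tree w Hxy) Hn).
  apply: (proj2 HU) => //; first exact: lift_at_test.
  by apply: test_fun_ext (lift_at_test y Hf) Ey.
- rewrite -Hphi; have E c : is_fch adj c -> lift_at x (fun=> 1) c = ((c 0%N).1 == x)%:R.
    by move=> Hc; rewrite (lift_atE _ _ (end_of_mem Hc)); case: eqP.
  have Ht := lift_at_test x (LCO_cst (1 : C) (adj := adj)).
  by apply: (proj2 HU) => //; apply: test_fun_ext Ht _.
Qed.

Lemma bch_rev c : is_bch adj c <-> is_fch adj (rev_chain c).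
Proof.
by split=> H n; have [H1 H2 H3] := H n; split=> //=; exact: adj_sym.
Qed.

Lemma fch_rev c : is_fch adj c <-> is_bch adj (rev_chain c).
Proof. by rewrite bch_rev rev_chainK. Qed.

Lemma is_preim_minus_rev (s : C) phi U : is_preim_minus q adj s phi U ->
  is_preim_plus q adj s phi (fun f => U (fun c => f (rev_chain c))).
Proof.
have Ht f : testF f -> test_fun (@cylB X) (is_bch adj) (fun c => f (rev_chain c)).
  exact: test_fun_rev bch_rev.
move=> [HU HL Hphi]; split=> [|f Hf|x]; last exact: Hphi.
  split=> [a f g Hf Hg|f g Hf Hg E]; first exact: (proj1 HU a _ _ (Ht _ Hf) (Ht _ Hg)).
  apply: (proj2 HU); [exact: Ht Hf|exact: Ht Hg|].
  by move=> c /bch_rev Hc; exact: E.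
rewrite -HL; last exact: Ht.
congr U; apply/funext => c; rewrite /Lplus /Lminus /rev_chain /=.
have -> : [set w | adj w (c 0%N).2 /\ w <> (c 0%N).1] = [set w | adj (c 0%N).2 w /\ w <> (c 0%N).1].
  by apply/seteqP; split=> w /= [H ?]; split=> //; exact: adj_sym.
apply: eq_fsbigr => w _; congr f; apply/funext => -[|n] //=.
Qed.

End ChainFunctionals.

Section Automorphisms.
Variables (R : realType) (q : nat) (X : choiceType) (adj : X -> X -> Prop).
Hypotheses (tree : is_tree adj) (reg : regular_deg q adj).
Local Notation Om := (@Omega X adj).
Local Notation C := R[i].
Local Notation LCO := (@LCO R X adj).

Lemma act_fch g c : is_aut adj g -> is_fch adj c -> is_fch adj (act g c).
Proof.
move=> [/bij_inj Hi Ha] Hc n; have [H1 H2 H3] := Hc n.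
by split=> /=; [rewrite -Ha|rewrite H2|move=> /Hi].
Qed.

Definition act_end (g : X -> X) (w : Om) : Om :=
  if pselect (exists w', actO g w w') is left H then sval (cid H) else w.

Lemma act_endP g (w : Om) : is_aut adj g -> actO g w (act_end g w).
Proof.
move=> Hg; rewrite /act_end; case: pselect => [H|[]]; first exact: (svalP (cid H)).
have [c Hc] := Omega_inhab w; exists (end_of (act_fch Hg (Omega_fch Hc))) => c' Hc'.
split; first exact: act_fch (Omega_fch Hc').
have [k [l H]] := Omega_ch_eq Hc Hc'.
by exists k, l => n; rewrite /act H.
Qed.

Arguments act_endP [g] w _ [c] _.

Lemma actO_uniq g (w w1 w2 : Om) : actO g w w1 -> actO g w w2 -> w1 = w2.
Proof. by have [c Hc] := Omega_inhab w; move=> /(_ c Hc) H1 /(_ c Hc); exact: Omega_eq H1. Qed.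

Lemma actO_eq g (w w' : Om) : is_aut adj g -> actO g w w' -> w' = act_end g w.
Proof. by move=> Hg H; apply: actO_uniq H (act_endP w Hg). Qed.

Lemma ray_act g x (w : Om) : is_aut adj g -> ray (g x) (act_end g w) = act g (ray x w).
Proof.
move=> Hg; apply: ray_uniq => //; first by apply: act_endP => //; exact: ray_mem.
by rewrite /act /= ray_start.
Qed.

Lemma nxt_act g x (w : Om) : is_aut adj g -> nxt (g x) (act_end g w) = g (nxt x w).
Proof. by move=> Hg; rewrite /nxt ray_act. Qed.

Lemma act_end_comp g h (w : Om) : is_aut adj g -> is_aut adj h -> is_aut adj (g \o h) ->
  act_end g (act_end h w) = act_end (g \o h) w.
Proof.
move=> Hg Hh Hgh; apply: actO_eq => // c Hc.
exact: (act_endP (act_end h w) Hg) (act_endP w Hh Hc).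
Qed.

Lemma act_end_id (w : Om) : act_end id w = w.
Proof.
apply/esym/actO_eq; first by split=> //; exists id.
move=> c; suff -> : act id c = c by [].
by apply/funext => n; rewrite /act -surjective_pairing.
Qed.

Lemma act_end_cont g (w : Om) b : is_aut adj g -> OmB b -> b (act_end g w) ->
  exists b', [/\ OmB b', b' w & forall u, b' u -> b (act_end g u)].
Proof.
move=> Hg Hb Hw; have [c Hc] := Omega_inhab w.
have [n Hn] := OmB_fch tree Hb Hw (act_endP w Hg Hc).
exists [set u | dplus (c n) u]; split; first exact: dplus_OmB.
  exact: dplus_mem.
move=> u /= Hu; apply: (Hn n) => //; rewrite /act; apply/dplusE => //.
by rewrite nxt_act //; congr g; apply/(dplusE tree); rewrite -surjective_pairing.
Qed.

Lemma LCO_act g f : is_aut adj g -> LCO f -> LCO (fun w => f (act_end g w)).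
Proof.
move=> Hg Hf w _; have [//|b [Hb [Hw H]]] := Hf (act_end g w).
have [b' [Hb' Hw' H']] := act_end_cont Hg Hb Hw.
by exists b'; do ?split=> //; move=> u _ /H'; exact: H.
Qed.

Lemma LCO2_act g K : is_aut adj g -> LCO2 K ->
  LCO2 (fun w' w => K (act_end g w') (act_end g w) : C).
Proof.
move=> Hg HK w' w; have [b1 [b2 [H1 H2 H3 H4 E]]] := HK (act_end g w') (act_end g w).
have [c1 [? ? F1]] := act_end_cont Hg H1 H3; have [c2 [? ? F2]] := act_end_cont Hg H2 H4.
by exists c1, c2; split=> // u' u /F1 ? /F2 ?; exact: E.
Qed.

Lemma eigenfamily_act (z : C) phi (N : X -> (Om -> C) -> C) g h : z != 0 -> z ^+ 2 != 1 ->
  is_aut adj g -> is_aut adj h -> cancel g h -> cancel h g ->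
  (forall x, phi (g x) = phi x) -> eigenfamily z phi N ->
  forall x f, LCO f -> N (g x) f = N x (fun w => f (act_end g w)).
Proof.
move=> Hz0 Hz Hg Hh gK hK Hphi [HN Hsh H1] x f Hf.
have ghK w : act_end g (act_end h w) = w.
  have E : g \o h = id by apply/funext.
  have Hid : is_aut adj (g \o h) by rewrite E; split=> //; exists id.
  by rewrite act_end_comp // E act_end_id.
suff HN' : eigenfamily z phi (fun x f => N (g x) (fun w => f (act_end h w))).
  have <- := eigenfamily_uniq tree reg Hz0 Hz HN' (And3 HN Hsh H1) x (LCO_act Hg Hf).
  by congr N; apply/funext => w; rewrite ghK.
split=> [y|y v f' Hyv Hf' Hs|y].
- split=> [a f1 f2 Hf1 Hf2|f1 f2 Hf1 Hf2 E].
    by rewrite -(proj1 (HN (g y))) //; exact: LCO_act.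
  by congr N; apply/funext => w; exact: E.
- apply: Hsh; [by case: Hg => _ <-|exact: LCO_act|move=> w Hw].
  by apply: Hs => E; apply: Hw; rewrite -{1}(ghK w) nxt_act // E.
- by rewrite H1.
Qed.
End Automorphisms.

Section Unfolding.
Variables (R : realType) (X : choiceType) (adj : X -> X -> Prop) (Gam : set (X -> X)).
Hypotheses (Hgrp : aut_subgroup adj Gam) (Hfree : acts_freely Gam).
Local Notation C := R[i].

Lemma Gam_aut g : Gam g -> is_aut adj g.
Proof. by case: Hgrp => H _ _ _; exact: H. Qed.

Lemma Gam_comp g h : Gam g -> Gam h -> Gam (g \o h).
Proof. by case: Hgrp => _ _ H _; exact: H. Qed.

Lemma Gam_inverse g : Gam g -> exists h, [/\ Gam h, cancel g h & cancel h g].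
Proof. by case: Hgrp => _ _ _ H; exact: H. Qed.

Lemma Gam_free g h x : Gam g -> Gam h -> g x = h x -> g = h.
Proof.
move=> Hg Hh E; have [k [Hk hK kK]] := Gam_inverse Hh.
have : (k \o g) = id by apply: (@Hfree _ x); [exact: Gam_comp|rewrite /= E hK].
by move=> Ek; apply/funext => y; rewrite -[LHS]kK -[k (g y)]/((k \o g) y) Ek.
Qed.

Definition orbit_reps (D : seq X) (rep : X -> X) (tr : X -> X -> X) :=
  [/\ uniq D, (forall x, rep x \in D), (forall d, d \in D -> rep d = d),
      (forall x, Gam (tr x) /\ x = tr x (rep x))
    & (forall g x, Gam g -> rep (g x) = rep x)].

Lemma orbit_reps_ex : finite_quotient Gam -> exists D rep tr, orbit_reps D rep tr.
Proof.
move=> [S HS]; pose P x := [set y | y \in S /\ exists g, Gam g /\ x = g y].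
pose rep x := xget x (P x).
have HP x : P x (rep x) by apply: xgetPex; have [g [y [? ? ?]]] := HS x; exists y; split=> //; exists g.
have Htr x : {g | Gam g /\ x = g (rep x)} by apply: cid; case: (HP x).
have Hxget (a b : X) Q : (exists y, Q y) -> xget a Q = xget b Q.
  by move=> [y Hy]; rewrite /xget; case: pselect => // -[]; exists y; exact/asboolP.
have Hinv g x : Gam g -> rep (g x) = rep x.
  move=> Hg; suff E : P (g x) = P x.
    by rewrite /rep E; apply: Hxget; exists (rep x).
  apply/seteqP; split=> y [Hy [h [Hh Eh]]]; split=> //.
    have [k [Hk gK kK]] := Gam_inverse Hg; exists (k \o h); split; first exact: Gam_comp.
    by rewrite /= -Eh gK.
  by exists (g \o h); split; [exact: Gam_comp|rewrite /= -Eh].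
have Hrep x : rep (rep x) = rep x by have [Hg E] := svalP (Htr x); rewrite -(Hinv _ (rep x) Hg) -E.
exists (undup (map rep S)), rep, (fun x => sval (Htr x)); split.
- exact: undup_uniq.
- by move=> x; rewrite mem_undup -Hrep; apply: map_f; case: (HP x).
- by move=> d; rewrite mem_undup => /mapP[x _ ->].
- by move=> x; exact: svalP (Htr x).
- exact: Hinv.
Qed.

Lemma eq_sum_support (I : eqType) (s t : seq I) (f : I -> C) : uniq s -> uniq t ->
  (forall i, f i != 0 -> (i \in s) = (i \in t)) -> \sum_(i <- s) f i = \sum_(i <- t) f i.
Proof.
move=> Hs Ht H; have E (r : seq I) : \sum_(i <- r) f i = \sum_(i <- [seq i <- r | f i != 0]) f i.
  by rewrite big_filter [RHS]big_mkcond; apply: eq_bigr => i _; case: eqP.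
rewrite E [RHS]E; apply/perm_big/uniq_perm; rewrite ?filter_uniq // => i.
by rewrite !mem_filter; case: eqVneq => //= /H.
Qed.

Lemma list_NoDup (I : eqType) (l : seq I) : List.NoDup l -> uniq l /\ forall i, i \in l <-> List.In i l.
Proof.
move=> Hnd; have Hin (l' : seq I) i : i \in l' <-> List.In i l'.
  elim: l' => [//|j l' IH]; rewrite inE; split=> [/orP[/eqP->|/IH]|[->|/IH->]]; rewrite ?eqxx ?orbT //; by [left|right].
split; last exact: Hin.
elim: l / Hnd => [//|j l H _ IH] /=; rewrite IH andbT; apply/negP => /Hin; exact: H.
Qed.

(* The cutoff [Xi] only has to sum to [1] where the invariant function [H] lives;
   this lets [Y] be all of [Omega * Omega] although cutoffs on [P] ignore the diagonal. *)
Lemma unfolding_sum D rep tr (Y : Type) (a : (X -> X) -> Y -> Y) (V : (Y -> C) -> Prop)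
    (T : X -> (Y -> C) -> C) (Xi H : X -> Y -> C) (S : seq X) :
  orbit_reps D rep tr ->
  lin_closed V -> (forall x, alg_dual V setT (T x)) ->
  (forall g x f, Gam g -> V f -> V (fun y => f (a g y)) /\ T (g x) f = T x (fun y => f (a g y))) ->
  (forall x, V (fun y => Xi x y * H x y)) ->
  (forall g x y, Gam g -> H (g x) (a g y) = H x y) ->
  uniq S -> (forall x y, Xi x y <> 0 -> H x y <> 0 -> x \in S) ->
  (forall x y, H x y <> 0 -> exists l : list (X -> X),
     [/\ List.NoDup l, forall g, List.In g l -> Gam g,
         forall g, Gam g -> Xi (g x) (a g y) <> 0 -> List.In g l
       & \sum_(g <- l) Xi (g x) (a g y) = 1]) ->
  \sum_(x <- S) T x (fun y => Xi x y * H x y) = \sum_(d <- D) T d (H d).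
Proof.
move=> [HD HrD HDr Htr Hrep] HV HT Heq HXV Hinv HS Hsupp Hcut.
transitivity (\sum_(x <- S) \sum_(d <- D | rep x == d) T x (fun y => Xi x y * H x y)).
  apply: eq_bigr => x _; rewrite big_mkcond (bigD1_seq (rep x)) //= eqxx big1 ?addr0 //.
  by move=> d; rewrite eq_sym => /negPf ->.
rewrite (exchange_big_dep xpredT) //=; apply: eq_big_seq => d Hd.
have Etr x : rep x = d -> x = tr x d by move=> <-; case: (Htr x).
have HXi x : rep x = d -> V (fun y => Xi x (a (tr x) y) * H d y) /\
    T x (fun y => Xi x y * H x y) = T d (fun y => Xi x (a (tr x) y) * H d y).
  move=> Ex; have [Hg _] := Htr x; have [HV1 HT1] := Heq _ d _ Hg (HXV x).
  have E : (fun y => Xi x (a (tr x) y) * H x (a (tr x) y)) = (fun y => Xi x (a (tr x) y) * H d y).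
    by apply/funext => y; rewrite -(Hinv _ d y Hg) -Etr.
  by rewrite -E; split=> //; rewrite -HT1 -Etr.
rewrite (eq_bigr (fun x => T d (fun y => Xi x (a (tr x) y) * H d y))); last first.
  by move=> x /eqP /HXi [].
rewrite -(dual_sum HV (HT d)); last by move=> x _ /eqP /HXi [].
congr (T d _); apply/funext => y; rewrite -mulr_suml.
have [->|N] := pselect (H d y = 0); first by rewrite mulr0.
have [l [/list_NoDup [Hl Hin] Hlg Hls Hsum]] := Hcut _ _ N.
rewrite -[RHS]mul1r -Hsum; congr (_ * _).
rewrite -big_filter (eq_big_seq (fun x => Xi (tr x d) (a (tr x) y))); last first.
  by move=> x; rewrite mem_filter => /andP[/eqP /Etr <-].
rewrite -(big_map tr xpredT (fun g => Xi (g d) (a g y))); apply: eq_sum_support => //.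
  rewrite map_inj_in_uniq ?filter_uniq // => x x'; rewrite !mem_filter.
  by move=> /andP[/eqP /Etr Ex _] /andP[/eqP /Etr Ex' _] E; rewrite Ex Ex' E.
move=> g /eqP Hg; apply/mapP/idP => [[x _ E]|/Hin/Hlg HGg].
  by apply/Hin/Hls => //; rewrite E; case: (Htr x).
have Er : rep (g d) = d by rewrite Hrep // HDr.
exists (g d); last by apply: (@Gam_free _ _ d) => //; [case: (Htr (g d))|rewrite -Etr].
rewrite mem_filter Er eqxx /=; apply: Hsupp Hg _.
by rewrite Hinv.
Qed.
End Unfolding.

Lemma conj_exponent (R : realType) (s : R[i]) :
  (2%:R^-1 + 'i * s)^* = 2%:R^-1 + 'i * - s^*.
Proof.
have Ei : conjc 'i = - 'i :> R[i] by apply/eqP; rewrite eq_complex /= oppr0 !eqxx.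
transitivity (conjc (2%:R^-1) + conjc ('i * s)); first exact: rmorphD.
rewrite conjc_inv conjc_nat mulrN -mulNr -Ei; congr (_ + _); exact: rmorphM.
Qed.

Section PattersonSullivan.
Variables (R : realType) (q : nat) (X : choiceType) (adj : X -> X -> Prop) (o : X).
Hypotheses (tree : is_tree adj) (reg : regular_deg q adj).
Local Notation Om := (@Omega X adj).
Local Notation C := R[i].
Local Notation LCO := (@LCO R X adj).
Implicit Types G F Xi : Om * Om * X -> C.

Definition off_diag G (x : X) (y : Om * Om) : C :=
  if nxt x y.2 == nxt x y.1 then 0 else G (y, x).

Lemma off_diagE G x y : inP (y, x) -> off_diag G x y = G (y, x).
Proof. by move=> /(inPE tree) /= H; rewrite /off_diag; case: eqP. Qed.

Lemma off_diag_inP G x y : off_diag G x y <> 0 -> inP (y, x).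
Proof. by move=> H; apply/(inPE tree) => /= E; apply: H; rewrite /off_diag E eqxx. Qed.

Lemma LCO2_off_diag G x : loc_const (@PB X adj) (@inP X adj) G ->
  LCO2 (fun w' w => off_diag G x (w', w)).
Proof.
move=> HG w' w; have [b1 [Hb1 [H1 E1]]] := nxt_loc_const tree x w'.
have [b2 [Hb2 [H2 E2]]] := nxt_loc_const tree x w.
have [E|/eqP N] := eqVneq (nxt x w) (nxt x w').
  by exists b1, b2; split=> // u' u /E1 Hu' /E2 Hu; rewrite /off_diag /= Hu Hu' E eqxx.
have Hp : inP (w', w, x) by apply/inPE.
have [_ [[c1 [c2 [x' [Hc1 Hc2 ->]]]] [/= [F1 F2 Ex] E]]] := HG _ Hp.
exists (b1 `&` c1), (b2 `&` c2); split=> //; try exact: OmB_setI.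
move=> u' u [/E1 Hu' ?] [/E2 Hu ?].
have Hp' : inP (u', u, x) by apply/inPE => //=; rewrite Hu Hu'.
by rewrite !off_diagE //; apply: E.
Qed.

Lemma LCO_off_diag2 G F x w : loc_const (@PB X adj) (@inP X adj) G ->
  loc_const (@PB X adj) (@inP X adj) F ->
  LCO (fun w' => off_diag G x (w', w) * off_diag F x (w', w)).
Proof.
move=> HG HF; apply: (@LCO2_l _ _ _ (fun w' w => off_diag G x (w', w) * off_diag F x (w', w))).
by apply: LCO2_mul; exact: LCO2_off_diag.
Qed.

Lemma test_fun_inP_support Xi : test_fun (@PB X adj) (@inP X adj) Xi ->
  exists S, uniq S /\ forall p, inP p -> Xi p <> 0 -> p.2 \in S.
Proof.
move=> [_ [K [_ [HK Hs]]]].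
have [x p /= Hp|p _|L HL] := HK X (fun x => [set p | p.2 = x]).
- exists [set p' | [/\ setT p'.1.1, setT p'.1.2 & p'.2 = x]]; split.
    by exists setT, setT, x; split=> //; exact: OmB_setT.
  by split=> // p' [].
- by exists p.2.
exists (undup L); split; first exact: undup_uniq.
by move=> p Hp /(Hs p Hp)/HL [x [Hx /= ->]]; exact: undup_list_In.
Qed.

Lemma ps_conj (s : C) x (w : Om) : (ps q o (- s^*) x w)^* = ps q o s x w.
Proof.
rewrite /ps cpowq_conj; congr cpowq.
transitivity (conjc (2%:R^-1 + 'i * - s^*) * conjc (horo o x w)%:~R); first exact: rmorphM.
rewrite -conj_exponent conjcK; congr (_ * _); exact: rmorph_int.
Qed.

Lemma PS_integrandE (s s' : C) Xi F (S : seq X) w' w : uniq S ->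
  (forall p, inP p -> Xi p <> 0 -> p.2 \in S) ->
  PS_integrand q o s s' Xi F w' w =
  \sum_(x <- S) off_diag Xi x (w', w) * off_diag F x (w', w) * ps q o s x w * ps q o (- s'^*) x w'.
Proof.
move=> HS Hsupp; rewrite /PS_integrand; case: asboolP => [E|N].
  by rewrite big1 // => x _; rewrite /off_diag E eqxx !mul0r.
set G := fun x => off_diag Xi x (w', w) * off_diag F x (w', w) * ps q o s x w * ps q o (- s'^*) x w'.
have Hin x : geod w' w x -> inP (w', w, x) by move=> /(geodE tree) H; apply/inPE.
transitivity (\sum_(x \in geod w' w) G x).
  by apply: eq_fsbigr => x /set_mem /Hin H; rewrite /G !off_diagE.
transitivity (\sum_(x \in [set: X]) G x).
  apply: fsbig_widen => // x [_ /= Hx]; rewrite /G /off_diag /=; case: eqP => [_|H]; first by rewrite !mul0r.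
  by case: Hx; apply/geodE.
rewrite (fsbig_seq _ _ HS); apply/esym/fsbig_widen => // x [_ /= Hx]; rewrite /G.
have [->|/[dup] /off_diag_inP H] := pselect (off_diag Xi x (w', w) = 0).
  by rewrite !mul0r.
by rewrite off_diagE // => /(Hsupp _ H).
Qed.

Lemma PSE (s s' : C) phi phi' mu mu' Xi F (S : seq X) : is_bv q o s phi mu -> is_bv q o s' phi' mu' ->
  loc_const (@PB X adj) (@inP X adj) Xi -> loc_const (@PB X adj) (@inP X adj) F -> uniq S ->
  (forall p, inP p -> Xi p <> 0 -> p.2 \in S) ->
  PS q o s s' mu mu' Xi F =
  \sum_(x <- S) mu (fun w => ps q o s x w *
     (mu' (fun w' => ps q o s' x w' * (off_diag Xi x (w', w) * off_diag F x (w', w))^*))^*).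
Proof.
move=> [Hmu _] [Hmu' _] HXi HF HS Hsupp; rewrite /PS /conj_dist.
have Hconj f : LCO f -> LCO (fun w => (f w)^*).
  by move=> Hf; apply: (LCO_comp (fun a : C => a^*)); apply/LCO_loc_const_map.
have HL x w : LCO (fun w' => ps q o s' x w' * (off_diag Xi x (w', w) * off_diag F x (w', w))^*).
  by apply: LCO_mul; [exact: LCO_ps|apply: Hconj; exact: LCO_off_diag2].
rewrite -(dual_sum (@LCO_closed R X adj) Hmu); last first.
  move=> x _ _; apply: LCO_mul; first exact: LCO_ps.
  apply: Hconj; apply: (@LCO2_dual R q X adj tree reg
    (fun w' w => ps q o s' x w' * (off_diag Xi x (w', w) * off_diag F x (w', w))^*) mu').
  apply: (@LCO2_op2 _ _ _ (fun a b => a * b^*) (fun w' w => ps q o s' x w')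
    (fun w' w => off_diag Xi x (w', w) * off_diag F x (w', w))); last first.
    by apply: LCO2_mul; exact: LCO2_off_diag.
  move=> w' w; have Hps : LCO (ps q o s' x) by exact: LCO_ps.
  have [//|b [Hb [Hw H]]] := Hps w'.
  by exists b, setT; split=> // [|u' u Hu' _]; [exact: OmB_setT|exact: H].
have Hc4 (a b c d : C) : conjc (a * b * c * d) = conjc c * (conjc d * conjc (a * b)).
  transitivity (conjc (a * b) * conjc c * conjc d); last by rewrite -mulrA mulrC -mulrA.
  by transitivity (conjc (a * b * c) * conjc d); [|congr (_ * _)]; exact: rmorphM.
congr mu; apply/funext => w.
under [X in mu' X]eq_fun do rewrite (PS_integrandE s s' F _ _ HS Hsupp).
transitivity ((mu' (fun w' => \sum_(x <- S) (ps q o s x w)^* *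
    (ps q o s' x w' * (off_diag Xi x (w', w) * off_diag F x (w', w))^*)))^*).
  congr (_^*); congr mu'; apply/funext => w'; rewrite rmorph_sum; apply: eq_bigr => x _.
  by rewrite -(ps_conj s'); exact: Hc4.
rewrite (dual_sum (@LCO_closed R X adj) Hmu'); last first.
  by move=> x _ _; apply: LCO_mul; [exact: LCO_cst|exact: HL].
transitivity (\sum_(x <- S) conjc (mu' (fun w' => conjc (ps q o s x w) *
    (ps q o s' x w' * conjc (off_diag Xi x (w', w) * off_diag F x (w', w)))))).
  exact: rmorph_sum.
apply: eq_bigr => x _; rewrite (dual_scale (@LCO_closed R X adj) Hmu'); last exact: HL.
by rewrite -[X in _ = X * _]conjcK; exact: rmorphM.
Qed.

Lemma embE (p : Om * Om * X) cp cm : emb p cp cm <->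
  [/\ inP p, cp = ray p.2 p.1.2 & cm = rev_chain (ray p.2 p.1.1)].
Proof.
split=> [[g [[Hg Hw Hw' H0] [-> ->]]]|[/(inPE tree) /(line_through tree) [g [Hg Hw Hw']] -> ->]].
  split.
  - split; last by exists g; split=> //; exists 0.
    by apply: (@geod_neq _ _ tree _ _ p.2); exists g; split=> //; exists 0.
  - by rewrite (ray_uniq tree Hw).
  - rewrite (ray_uniq tree Hw') /= ?oppr0 //; apply/funext => n.
    by rewrite /rev_chain /bwd_rev_of /=; congr (g _, g _); lia.
exists g; split; last split=> //.
- split=> //; first by rewrite Hw; exact: ray_mem.
    by rewrite Hw'; exact: ray_mem.
  by move/(congr1 (fun c => (c 0%N).1)): Hw; rewrite ray_start.
- rewrite -Hw'; apply/funext => n.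
  by rewrite /rev_chain /bwd_rev_of /=; congr (g _, g _); lia.
Qed.

Section Group.
Variable Gam : set (X -> X).
Hypotheses (Hgrp : aut_subgroup adj Gam) (Hfree : acts_freely Gam).
Variable F : Om * Om * X -> C.
Hypothesis HF : test_PG Gam F.

Definition act_ends (g : X -> X) (y : Om * Om) : Om * Om := (act_end g y.1, act_end g y.2).

Lemma inP_act g y x : is_aut adj g -> inP (y, x) <-> inP (act_ends g y, g x).
Proof.
move=> Hg; split=> /(inPE tree) /= H; apply/inPE => //=; move: H; rewrite !nxt_act //.
  by move=> H /(bij_inj (proj1 Hg)).
by move=> H E; apply: H; rewrite E.
Qed.

Lemma actP_ends g y x : is_aut adj g -> actP g (y, x) (act_ends g y, g x).
Proof. by move=> Hg; split=> //=; exact: act_endP. Qed.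

Lemma off_diag_act g x y : Gam g -> off_diag F (g x) (act_ends g y) = off_diag F x y.
Proof.
move=> HGg; have Hg := Gam_aut Hgrp HGg.
have [H|N] := pselect (inP (y, x)).
  have H' := proj1 (inP_act _ _ Hg) H; rewrite !off_diagE //.
  by apply: (proj2 HF) HGg H _; exact: actP_ends.
have Z (x' : X) y' : ~ inP (y', x') -> off_diag F x' y' = 0.
  by move=> H; apply: contrapT => /off_diag_inP.
by rewrite !Z // => H; apply: N; exact: (proj2 (inP_act _ _ Hg) H).
Qed.

Lemma rev_chain_act (g : X -> X) c : act g (rev_chain c) = rev_chain (act g c).
Proof. by []. Qed.

Lemma ray_inj x x' (w w' : Om) : ray x w = ray x' w' -> x = x' /\ w = w'.
Proof.
move=> E; split; first by rewrite -(ray_start tree x w) E ray_start.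
by apply: Omega_eq (ray_mem tree x w) _; rewrite E; exact: ray_mem.
Qed.

(* By freeness at most one [g] matches the two base points, so [extz] takes the value of [F]
   at a single glued geodesic. *)
Lemma extz_glue g x y (w w' : Om) : Gam g -> g y = x ->
  extz Gam F (ray x w) (rev_chain (ray y w')) = off_diag F x (act_end g w', w).
Proof.
move=> HGg Ey; have Hid : Gam id by case: Hgrp.
have Hg := Gam_aut Hgrp HGg.
have Hval v : (exists p g1 g2, [/\ Gam g1, Gam g2, inP p,
     emb p (act g1 (ray x w)) (act g2 (rev_chain (ray y w'))) & v = F p]) ->
   inP (act_end g w', w, x) /\ v = off_diag F x (act_end g w', w).
  move=> [[[u' u] x1] [g1 [g2 [HG1 HG2 Hp /embE [_]]]]] /=.
  have A1 := Gam_aut Hgrp HG1; have A2 := Gam_aut Hgrp HG2.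
  rewrite rev_chain_act -!(ray_act tree) // => /ray_inj [E1 Ew].
  move=> /(congr1 (@rev_chain X)); rewrite !rev_chainK => /ray_inj [E2 Ew'] ->.
  have E : g1 \o g = g2.
    by apply: (Gam_free Hgrp Hfree (x := y)) => //; [exact: (Gam_comp Hgrp)|rewrite /= Ey E1 E2].
  have Ep : (u', u, x1) = (act_ends g1 (act_end g w', w), g1 x).
    rewrite -Ew -Ew' -E1 /act_ends /= act_end_comp ?E //.
  rewrite Ep in Hp *; have Hp' : inP (act_end g w', w, x).
    by apply/(inP_act _ _ (Gam_aut Hgrp HG1)).
  by split=> //; rewrite -(off_diag_act _ _ HG1) off_diagE.
rewrite /extz; have [Hp|N] := pselect (inP (act_end g w', w, x)).
  apply: xget_unique => [|v /Hval [] //]; rewrite off_diagE //.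
  exists (act_end g w', w, x), id, g; split=> //; apply/embE; split=> //=.
    by apply/funext => n; rewrite /act -surjective_pairing.
  by rewrite rev_chain_act -ray_act // Ey.
rewrite xgetPN => [|v /Hval []//].
by apply/esym; apply: contrapT => /off_diag_inP.
Qed.

Lemma extz_nglue x y (w w' : Om) : (forall g, Gam g -> g y <> x) ->
  extz Gam F (ray x w) (rev_chain (ray y w')) = 0.
Proof.
move=> Hno; apply: xgetPN => v [[[u' u] x1] [g1 [g2 [HG1 HG2 _ /embE [_]]]]] /=.
have A1 := Gam_aut Hgrp HG1; have A2 := Gam_aut Hgrp HG2.
  rewrite rev_chain_act -!(ray_act tree) // => /ray_inj [E1 _].
move=> /(congr1 (@rev_chain X)); rewrite !rev_chainK => /ray_inj [E2 _] _.
have [h [Hh gK _]] := Gam_inverse Hgrp HG1.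
by apply: (Hno (h \o g2)); [exact: (Gam_comp Hgrp)|rewrite /= E2 -E1 gK].
Qed.

End Group.
End PattersonSullivan.

Section MainIdentity.
Variables (R : realType) (q : nat) (X : choiceType) (adj : X -> X -> Prop) (o : X).
Hypotheses (tree : is_tree adj) (reg : regular_deg q adj).
Variable Gam : set (X -> X).
Hypotheses (Hgrp : aut_subgroup adj Gam) (Hfree : acts_freely Gam).
Local Notation Om := (@Omega X adj).
Local Notation C := R[i].
Local Notation LCO := (@LCO R X adj).
Local Notation testF := (test_fun (R := R) (@cylB X) (is_fch adj)).
Local Notation V2 := (fun f : Om * Om -> C => LCO2 (fun w' w => f (w', w))).

Lemma iterated_dual (N N' : (Om -> C) -> C) : distO N -> distO N' ->
  alg_dual V2 setT (fun f => N (fun w => N' (fun w' => f (w', w)))).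
Proof.
move=> HN HN'; have HL f : V2 f -> LCO (fun w => N' (fun w' => f (w', w))).
  by move=> Hf; apply: (LCO2_dual tree reg N' Hf).
split=> [a f g Hf Hg|f g Hf Hg E]; last first.
  by congr N; apply/funext => w; congr N'; apply/funext => w'; exact: E.
rewrite -(proj1 HN); [|exact: HL|exact: HL].
congr N; apply/funext => w; rewrite -(proj1 HN') //; [exact: (LCO2_l w Hf)|exact: (LCO2_l w Hg)].
Qed.

Lemma eigenfamily_Gam (z : C) phi (N : X -> (Om -> C) -> C) g x f :
  z != 0 -> z ^+ 2 != 1 -> Gam_inv Gam phi -> eigenfamily z phi N -> Gam g -> LCO f ->
  N (g x) f = N x (fun w => f (act_end g w)).
Proof.
move=> Hz0 Hz Hphi HN HGg Hf; have [h [Hh gK hK]] := Gam_inverse Hgrp HGg.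
apply: (eigenfamily_act tree reg Hz0 Hz (Gam_aut Hgrp HGg) (Gam_aut Hgrp Hh) gK hK _ HN) => //.
by move=> y; exact: Hphi.
Qed.

Variables (D : seq X) (rep : X -> X) (tr : X -> X -> X).
Hypothesis Hrep : orbit_reps Gam D rep tr.
Variables (z z' : C) (phi phi' : X -> C) (N N' : X -> (Om -> C) -> C).
Hypotheses (Hz0 : z != 0) (Hz : z ^+ 2 != 1) (Hz0' : z' != 0) (Hz' : z' ^+ 2 != 1).
Hypotheses (Hphi : Gam_inv Gam phi) (Hphi' : Gam_inv Gam phi').
Hypotheses (HN : eigenfamily z phi N) (HN' : eigenfamily z' phi' N').
Variable F : Om * Om * X -> C.
Hypothesis HF : test_PG Gam F.

Definition vertex_pairing (x : X) (f : Om * Om -> C) : C :=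
  N x (fun w => N' x (fun w' => f (w', w))).

Lemma distO_eigen x : distO (N x). Proof. by case: HN. Qed.
Lemma distO_eigen' x : distO (N' x). Proof. by case: HN'. Qed.

Lemma vertex_pairing_act g x f : Gam g -> V2 f ->
  vertex_pairing (g x) f = vertex_pairing x (fun y => f (act_ends g y)).
Proof.
move=> HGg Hf; rewrite /vertex_pairing.
rewrite (eigenfamily_Gam x Hz0 Hz Hphi HN HGg); last exact: (LCO2_dual tree reg (N' (g x)) Hf).
congr (N x _); apply/funext => w.
rewrite (eigenfamily_Gam x Hz0' Hz' Hphi' HN' HGg) //.
exact: LCO2_l (act_end g w) Hf.
Qed.

Lemma PS_unfold s s' mu mu' XiP : is_bv q o s phi mu ->
  (exists phi0, is_bv q o s' phi0 mu') ->
  (forall x f, LCO f -> mu (fun w => ps q o s x w * f w) = N x f) ->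
  (forall x f, LCO f -> conjc (mu' (fun w => ps q o s' x w * conjc (f w))) = N' x f) ->
  cutoff_P Gam XiP ->
  PS q o s s' mu mu' XiP F = \sum_(d <- D) vertex_pairing d (off_diag F d).
Proof.
move=> Hmu [phi0 Hmu'] EN EN' [HXi Hcut].
have [S [HS Hsupp]] := test_fun_inP_support HXi.
have [HXl _] := HXi; have [HFl _] := HF.
have HK x : V2 (fun y => off_diag XiP x y * off_diag F x y).
  by apply: LCO2_mul; exact: LCO2_off_diag.
rewrite (PSE tree reg Hmu Hmu' HXl HFl HS Hsupp).
transitivity (\sum_(x <- S) vertex_pairing x (fun y => off_diag XiP x y * off_diag F x y)).
  apply: eq_bigr => x _.
  transitivity (mu (fun w => ps q o s x w * N' x (fun w' => off_diag XiP x (w', w) * off_diag F x (w', w)))).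
    congr mu; apply/funext => w; congr (_ * _).
    by rewrite -EN' //; exact: LCO_off_diag2.
  by rewrite EN //; exact: (LCO2_dual tree reg (N' x) (HK x)).
apply: (unfolding_sum Hgrp Hfree (a := @act_ends _ adj) (V := V2) (T := vertex_pairing)
  (Xi := off_diag XiP) (H := off_diag F) Hrep) => //.
- exact: LCO2_closed.
- by move=> x; exact: (iterated_dual (distO_eigen x) (distO_eigen' x)).
- move=> g x f HGg Hf; split; last exact: vertex_pairing_act.
  by apply: (LCO2_act tree (K := fun w' w => f (w', w))) => //; exact: Gam_aut Hgrp _ HGg.
- by move=> g x y HGg; exact: (off_diag_act tree Hgrp).
- by move=> x y HX /(off_diag_inP tree) Hp; apply: (Hsupp (y, x)); rewrite // -off_diagE.
move=> x y /(off_diag_inP tree) Hp; have [l [Hl1 Hl2 Hl3 Hl4]] := Hcut _ Hp.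
have Hval g : Gam g -> val_at XiP g (y, x) = off_diag XiP (g x) (act_ends g y).
  move=> HGg; have Hg := Gam_aut Hgrp HGg.
  rewrite off_diagE //; last exact: (proj1 (inP_act tree _ _ Hg) Hp).
  apply: xget_unique; first by exists (act_ends g y, g x); split=> //; exact: actP_ends.
  move=> _ [[[u' u] v] [[/= H1 H2 H3] ->]].
  by rewrite H3 (actO_eq Hg H1) (actO_eq Hg H2).
exists l; split=> // [g HGg|]; first by rewrite -Hval //; exact: Hl3.
have [_ Hin] := list_NoDup Hl1.
rewrite -Hl4 big_seq [RHS]big_seq; apply: eq_bigr => g /Hin /Hl2 HGg.
by rewrite Hval.
Qed.

Lemma tensor_unfold Up Um Xip Xim :
  alg_dual testF (is_fch adj) Up ->
  alg_dual testF (is_fch adj) (fun f => Um (fun c => f (rev_chain c))) ->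
  (forall x f, Up (lift_at x f) = N x f) ->
  (forall x f, Um (fun c => lift_at x f (rev_chain c)) = N' x f) ->
  cutoff_pm Gam (is_fch adj) Xip -> cutoff_pm Gam (is_bch adj) Xim ->
  tensorG (Ipm Up Xip) (Ipm Um Xim) (extz Gam F) =
  \sum_(d <- D) vertex_pairing d (off_diag F d).
Proof.
move=> HUp HUm EN EN' [HXp Hcp] [HXm Hcm].
have [HFl _] := HF.
have HK x : V2 (off_diag F x) by exact: LCO2_off_diag.
pose Umr := fun f => Um (fun c => f (rev_chain c)).
have HUmr : alg_dual testF (is_fch adj) Umr by [].
pose Xim' c := Xim (rev_chain c).
have HXm' : testF Xim' by apply: test_fun_rev HXm => c; exact: fch_rev.
have [Sm [HSm Hsm]] := test_fun_support HXm'.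
have [Sp [HSp Hsp]] := test_fun_support HXp.
have [HD HrD HDr Htr Hrepg] := Hrep.
have Hext w x y g : Gam g -> g y = x ->
    (fun w' => extz Gam F (ray x w) (rev_chain (ray y w'))) = (fun w' => off_diag F x (act_end g w', w)).
  by move=> HGg Ey; apply/funext => w'; exact: (extz_glue tree Hgrp Hfree HF).
have Hext0 (w : Om) x y : rep x <> rep y ->
    (fun w' : Om => extz Gam F (ray x w) (rev_chain (ray y w'))) = (fun=> 0).
  move=> N0; apply/funext => w'; rewrite (extz_nglue tree Hgrp) // => g HGg Eg.
  by apply: N0; rewrite -Eg Hrepg.
have Hsame x y : rep x = rep y -> exists2 g, Gam g & g y = x.
  move=> E; have [Hx Ex] := Htr x; have [Hy Ey] := Htr y.
  have [h [Hh hK _]] := Gam_inverse Hgrp Hy.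
  exists (tr x \o h); first exact: (Gam_comp Hgrp).
  by rewrite /= [X in h X]Ey hK -E -Ex.
have HLext (w : Om) x y : LCO (fun w' => extz Gam F (ray x w) (rev_chain (ray y w'))).
  have [/Hsame [g HGg Ey]|N0] := pselect (rep x = rep y); last by rewrite Hext0 //; exact: LCO_cst.
  rewrite (Hext w x y g HGg Ey).
  apply: (LCO_act tree (f := fun w' => off_diag F x (w', w))); first exact: Gam_aut Hgrp _ HGg.
  exact: LCO2_l w (HK x).
have Hinner x w : Um (fun cm => extz Gam F (ray x w) cm * Xim cm) = N' x (fun w' => off_diag F x (w', w)).
  transitivity (Umr (fun c => extz Gam F (ray x w) (rev_chain c) * Xim' c)).
    by congr Um; apply/funext => c; rewrite /Xim' rev_chainK.
  rewrite (chain_dual_sum tree reg HUmr HSm); first last.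
  - by move=> c Hc H; apply: Hsm => // E; apply: H; rewrite E mulr0.
  - by move=> y _; apply: LCO_mul; [exact: HLext|exact: (test_fun_ray tree)].
  transitivity (\sum_(y <- Sm) N' y (fun w' => Xim' (ray y w') * extz Gam F (ray x w) (rev_chain (ray y w')))).
    by apply: eq_bigr => y _; rewrite /Umr EN'; congr (N' y _); apply/funext => w'; rewrite mulrC.
  rewrite (unfolding_sum Hgrp Hfree (a := @act_end _ adj) (V := LCO) (T := N')
    (Xi := fun y w' => Xim' (ray y w'))
    (H := fun y w' => extz Gam F (ray x w) (rev_chain (ray y w'))) Hrep) //.
  - rewrite (bigD1_seq (rep x)) //= big_seq_cond big1 ?addr0; last first.
      move=> d /andP[Hd /eqP Nd]; rewrite Hext0; last by rewrite (HDr _ Hd) => E; apply: Nd.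
      exact: (dual0 (LCO_closed R adj) (distO_eigen' d)).
    have [HGg Ex] := Htr x; rewrite (Hext w x _ _ HGg (esym Ex)).
    by have := eigenfamily_Gam (rep x) Hz0' Hz' Hphi' HN' HGg (LCO2_l w (HK x)); rewrite -Ex => ->.
  - exact: LCO_closed.
  - exact: distO_eigen'.
  - move=> g y f HGg Hf; split; first by apply: (LCO_act tree) => //; exact: Gam_aut Hgrp _ HGg.
    exact: eigenfamily_Gam Hz0' Hz' Hphi' HN' HGg Hf.
  - by move=> y; apply: LCO_mul; [exact: (test_fun_ray tree)|exact: HLext].
  - move=> g y w' HGg; have Hg := Gam_aut Hgrp HGg.
    have [/[dup] Exy /Hsame [h HGh Eh]|N0] := pselect (rep x = rep (g y)).
      rewrite (extz_glue tree Hgrp Hfree HF _ _ HGh Eh).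
      rewrite (extz_glue tree Hgrp Hfree HF _ _ (Gam_comp Hgrp HGh HGg) Eh).
      rewrite act_end_comp //; first exact: (Gam_aut Hgrp HGh).
      exact: Gam_aut Hgrp _ (Gam_comp Hgrp HGh HGg).
    transitivity (0 : C); first by move/(congr1 (fun f => f (act_end g w'))): (Hext0 w _ _ N0).
    by rewrite Hrepg // in N0; move/(congr1 (fun f => f w')): (Hext0 w _ _ N0).
  - move=> y w' H _; have := Hsm _ (ray_fch tree y w') H.
    by rewrite ray_start.
  move=> y w' _; have [l [Hl1 Hl2 Hl3 Hl4]] := Hcm _ (proj1 (fch_rev tree _) (ray_fch tree y w')).
  have Hact g : Gam g -> Xim' (ray (g y) (act_end g w')) = Xim (act g (rev_chain (ray y w'))).
    by move=> HGg; rewrite (ray_act tree) //; exact: Gam_aut Hgrp _ HGg.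
  exists l; split=> // [g HGg|]; first by rewrite Hact //; exact: Hl3.
  have [_ Hin] := list_NoDup Hl1.
  rewrite -Hl4 big_seq [RHS]big_seq; apply: eq_bigr => g /Hin /Hl2 HGg.
  by rewrite Hact.
pose H x w := N' x (fun w' => off_diag F x (w', w)).
have HH x : LCO (H x) by exact: (LCO2_dual tree reg (N' x) (HK x)).
rewrite /tensorG /Ipm (chain_dual_sum tree reg HUp HSp); first last.
- by move=> c Hc H0; apply: Hsp => // E; apply: H0; rewrite E mulr0.
- move=> x _; apply: LCO_mul; last exact: (test_fun_ray tree).
  by have -> : (fun w => Um (fun cm => extz Gam F (ray x w) cm * Xim cm)) = H x
    by apply/funext => w; exact: Hinner.
transitivity (\sum_(x <- Sp) N x (fun w => Xip (ray x w) * H x w)).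
  by apply: eq_bigr => x _; rewrite EN; congr (N x _); apply/funext => w; rewrite Hinner mulrC.
apply: (unfolding_sum Hgrp Hfree (a := @act_end _ adj) (V := LCO) (T := N)
  (Xi := fun x w => Xip (ray x w)) (H := H) Hrep) => //.
- exact: LCO_closed.
- exact: distO_eigen.
- move=> g y f HGg Hf; split; first by apply: (LCO_act tree) => //; exact: Gam_aut Hgrp _ HGg.
  exact: eigenfamily_Gam Hz0 Hz Hphi HN HGg Hf.
- by move=> x; apply: LCO_mul; [exact: (test_fun_ray tree)|exact: HH].
- move=> g x w HGg; rewrite /H (eigenfamily_Gam x Hz0' Hz' Hphi' HN' HGg); last exact: LCO2_l _ (HK _).
  congr (N' x _); apply/funext => w'.
  exact: (off_diag_act tree Hgrp HF x (w', w) HGg).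
- move=> x w Hx _; have := Hsp _ (ray_fch tree x w) Hx.
  by rewrite ray_start.
move=> x w _; have [l [Hl1 Hl2 Hl3 Hl4]] := Hcp _ (ray_fch tree x w).
have Hact g : Gam g -> Xip (ray (g x) (act_end g w)) = Xip (act g (ray x w)).
  by move=> HGg; rewrite (ray_act tree) //; exact: Gam_aut Hgrp _ HGg.
exists l; split=> // [g HGg|]; first by rewrite Hact //; exact: Hl3.
have [_ Hin] := list_NoDup Hl1.
rewrite -Hl4 big_seq [RHS]big_seq; apply: eq_bigr => g /Hin /Hl2 HGg.
by rewrite Hact.
Qed.

End MainIdentity.

Theorem theorem3p14 (R : realType) (q : nat) (X : choiceType)
  (adj : X -> X -> Prop) (o : X) (Gam : set (X -> X)) :
  (2 <= q)%N -> is_tree adj -> regular_deg q adj ->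
  aut_subgroup adj Gam -> discrete_grp Gam -> acts_freely Gam -> finite_quotient Gam ->
  forall s s' : R[i],
  chi q s <> 1 -> chi q s <> -1 -> chi q s' <> 1 -> chi q s' <> -1 ->
  forall phi phi' : X -> R[i],
  Gam_inv Gam phi -> Gam_inv Gam phi' ->
  (forall x, Lap q adj phi x = chi q s * phi x) ->
  (forall x, Lap q adj phi' x = chi q s' * phi' x) ->
  (* boundary values mu = mu_{s,phi}, mu' = mu_{s',phi'} *)
  forall mu mu' : (Omega adj -> R[i]) -> R[i],
  is_bv q o s phi mu -> is_bv q o s' phi' mu' ->
  (* Up = (pi_{+,*})^{-1}(phi) in E_s(L'_+),
     Um = (pi_{-,*})^{-1}(conj phi') in E_{-conj s'}(L'_-) *)
  forall Up Um : ((nat -> X * X) -> R[i]) -> R[i],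
  is_preim_plus q adj s phi Up ->
  is_preim_minus q adj (- s'^*) (fun x => (phi' x)^*) Um ->
  (* cutoff functions Xi_P, Xi_+, Xi_- *)
  forall (XiP : Omega adj * Omega adj * X -> R[i]) (Xip Xim : (nat -> X * X) -> R[i]),
  cutoff_P Gam XiP -> cutoff_pm Gam (is_fch adj) Xip -> cutoff_pm Gam (is_bch adj) Xim ->
  (* equality in D'(P_Gamma): tested against every F in C^lc(P_Gamma) *)
  forall F : Omega adj * Omega adj * X -> R[i],
  test_PG Gam F ->
  PS q o s s' mu mu' XiP F =
  tensorG (Ipm Up Xip) (Ipm Um Xim) (extz Gam F).
Proof.
move=> q2 tree reg Hgrp _ Hfree Hfin s s' c1 c2 c3 c4 phi phi' Hphi Hphi' _ _.
move=> mu mu' Hmu Hmu' Up Um HUp HUm XiP Xip Xim HXiP HXip HXim F HF.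
have [D [rep [tr Hrep]]] := orbit_reps_ex Hgrp Hfin.
have HUr := is_preim_minus_rev tree HUm.
have HN := eigenfamily_chain tree reg HUp.
have HN' := eigenfamily_chain tree reg HUr.
have HM := eigenfamily_bv tree Hmu.
have HM' := eigenfamily_conj (eigenfamily_bv tree Hmu').
have Hz := chi_sqr_neq1 q2 c1 c2; have Hz0 := cpowq_neq0 q (2%:R^-1 + 'i * s).
have Hz0' := cpowq_neq0 q (2%:R^-1 + 'i * - s'^*).
rewrite cpowq_conj conj_exponent in HM'.
have Hz' : cpowq q (2%:R^-1 + 'i * - s'^*) ^+ 2 != 1.
  apply: contra (chi_sqr_neq1 q2 c3 c4) => /eqP E.
  rewrite -[cpowq q _]conjcK cpowq_conj conj_exponent.
  by apply/eqP; transitivity (conjc (cpowq q (2%:R^-1 + 'i * - s'^*) ^+ 2));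
    [exact/esym/rmorphXn|rewrite E conjc1].
have Hphi'c : Gam_inv Gam (fun x => (phi' x)^*) by move=> g x Hg; rewrite Hphi'.
rewrite (tensor_unfold tree reg Hgrp Hfree Hrep Hz0 Hz Hz0' Hz' Hphi Hphi'c HN HN' HF) //; first last.
- by case: HUr.
- by case: HUp.
apply: (PS_unfold tree reg Hgrp Hfree Hrep Hz0 Hz Hz0' Hz' Hphi Hphi'c HN HN' HF) => //.
- by exists phi'.
- by move=> x f Hf; exact: (eigenfamily_uniq tree reg Hz0 Hz HM HN x Hf).
by move=> x f Hf; exact: (eigenfamily_uniq tree reg Hz0' Hz' HM' HN' x Hf).
Qed.
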